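(* Let $\Sigma=\operatorname{diag}(\mu_1,\dots,\mu_n)$ with $\mu_1>\mu_2>\dots>\mu_n>0$, and let $\mathcal O^{\mathrm{svd}}_\Sigma=\{Q^\top\Sigma U : Q,U\in\mathbf O\}$ be the set of real $n\times n$ matrices with singular values $\mu_1,\dots,\mu_n$. Let $N=\dim\mathcal O_\Sigma^{\mathrm{svd}}$. Then $\mathcal O^{\mathrm{svd}}_\Sigma$ admits an atlas with charts indexed by $(\pi,\rho,E)\in S_n\times S_n\times\mathcal D^{\mathrm{sgn}}$, $$\phi_{\pi,\rho,E}:\mathcal U_{\pi,\rho,E}\subset\mathcal O^{\mathrm{svd}}_\Sigma\to\mathbb R^N,$$ such that: 1. Each $\mathcal U_{\pi,\rho,E}$ is an open subset of $\mathcal O^{\mathrm{svd}}_\Sigma$, and each chart $\phi_{\pi,\rho,E}$ is a diffeomorphism (onto $\mathbb R^N$). 2. The sets $\mathcal U_{\pi,\rho,E}$ are invariant under the SVD flows. In these variables (i.e. in the images of the charts), the SVD flow associated with a real polynomial $p$ is $\dot v=Cv$, $v\in\mathbb R^N$, for a constant diagonal matrix $C$ (depending on $p$).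
   Context: All matrices are real $n\times n$. $\mathbf O$ is the orthogonal group, $S_n$ the symmetric group on $\{1,\dots,n\}$, and $\mathcal D^{\mathrm{sgn}}$ the group of diagonal matrices with diagonal entries $\pm1$. Let $\mathcal M$ be the space of real $n\times n$ matrices, $\mathfrak o\subset\mathcal M$ the skew-symmetric matrices and $\mathfrak{up}\subset\mathcal M$ the upper triangular matrices, so that $\mathcal M=\mathfrak o\oplus\mathfrak{up}$; let $\Pi_{\mathfrak o}:\mathcal M\to\mathfrak o$ be the associated projection. For a real polynomial $p$, the SVD flow associated with $p$ is the flow of $$\dot M=M\,\big(\Pi_{\mathfrak o}\,p(M^\top M)\big)-\big(\Pi_{\mathfrak o}\,p(MM^\top)\big)\,M,$$ which preserves singular values. The charts do not depend on $p$; the matrix $C$ may depend on the chart. *)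

(* Defs.v *)
From HB Require Import structures.
From mathcomp Require Import all_boot all_order all_algebra all_fingroup.
From mathcomp Require Import all_classical all_reals all_analysis.

Set Implicit Arguments.
Unset Strict Implicit.
Unset Printing Implicit Defensive.

Import Order.TTheory GRing.Theory Num.Theory.
Import numFieldNormedType.Exports.

Local Open Scope classical_set_scope.
Local Open Scope ring_scope.

Section Smooth.
Variables (R : realType) (V W : normedModType R).

(* C^infty on an open set A of a finite-dimensional space: every iterated
   directional derivative D_{v_1} ... D_{v_k} f (k >= 0) is differentiable at
   every point of A. Only meaningful for A open. *)
Definition smooth (A : set V) (f : V -> W) :=
  forall (vs : seq V) (x : V), A x ->
    differentiable (foldr (fun v (g : V -> W) => 'D_v g) f vs) x.

(* Smoothness on an arbitrary subset A of V: locally the restriction of a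
   smooth map defined on an open set of the ambient space. On an embedded
   submanifold this is smoothness for the induced manifold structure. *)
Definition smooth_on (A : set V) (f : V -> W) :=
  forall x, A x -> exists (X : set V) (g : V -> W),
    [/\ open X, X x, smooth X g & forall y, A y -> X y -> f y = g y].

Definition relatively_open (S U : set V) :=
  exists2 X : set V, open X & U = S `&` X.

End Smooth.

Definition diffeomorphism (R : realType) (V W : normedModType R)
    (A : set V) (B : set W) (f : V -> W) :=
  [/\ set_bij A B f, smooth_on A f
    & exists2 g : W -> V, smooth_on B g & {in A, cancel f g}].

(* S is an embedded smooth manifold of dimension N: it is locally diffeomorphic
   to open subsets of R^N. *)
Definition manifold_dim (R : realType) (V : normedModType R) (N : nat)
    (S : set V) :=
  forall x, S x -> exists (U : set V) (B : set 'cV[R]_N) (f : V -> 'cV[R]_N),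
    [/\ relatively_open S U, U x, open B & diffeomorphism U B f].

(* The family (U i, phi i), i in I, is an atlas of S all of whose charts map
   onto R^N. The smooth structure on S is the one induced by the ambient space,
   so charts are automatically compatible: phi i \o (phi j)^-1 is a composition
   of diffeomorphisms. *)
Definition atlas_onto (R : realType) (V : normedModType R) (N : nat)
    (S : set V) (T : Type) (I : set T)
    (U : T -> set V) (phi : T -> V -> 'cV[R]_N) :=
  [/\ S = \bigcup_(i in I) U i,
      forall i, I i -> relatively_open S (U i)
    & forall i, I i -> diffeomorphism (U i) [set: 'cV[R]_N] (phi i)].

(* gamma solves gamma' = X(gamma) on the time set J (an open interval when
   used). *)
Definition integral_curve (R : realType) (V : normedModType R)
    (X : V -> V) (J : set R) (gamma : R -> V) :=
  forall t, J t -> is_derive t (1 : R) gamma (X (gamma t)).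

Section SVD.
Variables (R : realType) (n : nat).
Implicit Types A M Q U E : 'M[R]_n.

Definition orthogonal_mx : set 'M[R]_n := [set Q | Q^T *m Q = 1%:M].

Definition sign_diag : set 'M[R]_n :=
  [set E | is_diag_mx E /\ forall i, E i i = 1 \/ E i i = -1].

Definition skew_mx : set 'M[R]_n := [set A | A^T = - A].

(* MathComp's is_trig_mx means lower triangular. *)
Definition upper_mx : set 'M[R]_n := [set A | is_trig_mx A^T].

(* Projection onto skew-symmetric matrices along upper triangular ones;
   see proj_skewP. *)
Definition proj_skew A : 'M[R]_n :=
  \matrix_(i, j) (if (j < i)%N then A i j
                  else if (i < j)%N then - A j i else 0).

Lemma proj_skewP A S :
  proj_skew A = S <-> skew_mx S /\ upper_mx (A - S).
Proof.
split=> [<-|[skS /is_trig_mxP upS]].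
  split; first by apply/matrixP => i j; rewrite !mxE; case: ltngtP;
    rewrite ?opprK ?oppr0.
  by apply/is_trig_mxP => i j ij; rewrite !mxE ij subrr.
have low (i j : 'I_n) : (j < i)%N -> S i j = A i j.
  by move=> ji; move: (upS _ _ ji); rewrite !mxE => /subr0_eq.
have sk (i j : 'I_n) : S j i = - S i j by move/matrixP/(_ i j): skS; rewrite !mxE.
apply/matrixP => i j; rewrite mxE; case: ltngtP => [ji|ij|/val_inj eij].
- by rewrite low.
- by rewrite -(low _ _ ij) -sk.
- apply/esym/eqP; move/eqP: (sk i i); rewrite eij.
  by rewrite -addr_eq0 -mulr2n mulrn_eq0.
Qed.

Definition svd_orbit (Sigma : 'M[R]_n) : set 'M[R]_n :=
  [set M | exists Q U, [/\ orthogonal_mx Q, orthogonal_mx U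
                         & M = Q^T *m Sigma *m U]].

End SVD.

Definition svd_field (R : realType) (n : nat) (p : {poly R})
    (M : 'M[R]_n.+1) : 'M[R]_n.+1 :=
  M *m proj_skew (horner_mx (M^T *m M) p)
  - proj_skew (horner_mx (M *m M^T) p) *m M.

(* The index set S_n x S_n x D^sgn. *)
Definition chart_index (R : realType) (n : nat) :
    set ('S_n * 'S_n * 'M[R]_n) :=
  [set i | sign_diag i.2].

(* Main.v *)
(* Write M = Q^T S U with Q = P L R and U = E P' L' R', where P, P' are
   permutation matrices, E is a diagonal sign matrix, L, L' are unit lower
   triangular and R, R' are upper triangular with positive diagonal.  The charts
   are M |-> (L, L'): conversely Q and E U are the Gram-Schmidt
   orthonormalizations of P L and P' L', and (Q, U) is determined by M up to a
   common diagonal sign matrix, which the positivity of the diagonals fixes.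

   If dL/dt = D L - L D with P D = p(S^2) P, then A = P L satisfies
   dA/dt = p(S^2) A - A D; as Q = A R, the skew-symmetric part of
   Q^T (dA/dt) R is Q^T dQ/dt, so that
   dQ/dt = Q Pi(Q^T p(S^2) Q) = Q Pi(p(M M^T)), with Pi the projection of the
   statement.  Together with the same computation for U, this shows that the
   entries of L and L', which evolve by dL_ij/dt = (D_i - D_j) L_ij, are linear
   coordinates for the flow.  As these linear curves exist for all times,
   uniqueness of solutions shows that the chart domains are invariant and that
   every solution has this form. *)
Require Import Defs.
From HB Require Import structures.
From mathcomp Require Import all_boot all_order all_algebra all_fingroup.
From mathcomp Require Import all_classical all_reals all_analysis.
From mathcomp Require Import ring.
Import Order.TTheory GRing.Theory Num.Theory.
Import numFieldNormedType.Exports.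
Local Open Scope classical_set_scope.
Local Open Scope ring_scope.

Set Implicit Arguments.
Unset Strict Implicit.

(** * LU factorization with positive pivots *)

Section TriangularFactorization.
Variable R : realType.

Definition pos_upper n (A : 'M[R]_n) := upper_mx A /\ forall i, 0 < A i i.

Definition unit_lower n (A : 'M[R]_n) := is_trig_mx A /\ forall i, A i i = 1.

Lemma upper_mxP n (A : 'M[R]_n) :
  upper_mx A <-> forall i j : 'I_n, (j < i)%N -> A i j = 0.
Proof.
split=> [|upA]; rewrite /upper_mx/=.
  by move/is_trig_mxP => upA i j ji; have := upA j i ji; rewrite mxE.
by apply/is_trig_mxP => i j ij; rewrite mxE upA.
Qed.

Lemma upper_mxM n (A B : 'M[R]_n) :
  upper_mx A -> upper_mx B -> upper_mx (A *m B).
Proof.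
move=> /upper_mxP upA /upper_mxP upB; apply/upper_mxP => i j ji.
rewrite mxE big1// => k _; have [ki|ik] := ltnP k i; first by rewrite upA ?mul0r.
by rewrite upB ?mulr0// (leq_trans ji).
Qed.

Lemma upper_mxM_diag n (A B : 'M[R]_n) i :
  upper_mx A -> upper_mx B -> (A *m B) i i = A i i * B i i.
Proof.
move=> /upper_mxP upA /upper_mxP upB; rewrite mxE (bigD1 i)//= big1 ?addr0// => k.
rewrite -val_eqE neq_ltn => /orP[ki|ik]; first by rewrite upA ?mul0r.
by rewrite upB ?mulr0.
Qed.

Lemma pos_upperM n (A B : 'M[R]_n) :
  pos_upper A -> pos_upper B -> pos_upper (A *m B).
Proof.
move=> [upA A0] [upB B0]; split=> [|i]; first exact: upper_mxM.
by rewrite upper_mxM_diag// mulr_gt0.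
Qed.

Lemma pos_upper_unitmx n (A : 'M[R]_n) : pos_upper A -> A \in unitmx.
Proof.
move=> [upA A0]; rewrite unitmxE -det_tr det_trig//.
by rewrite unitfE; apply/prodf_neq0 => i _; rewrite mxE gt_eqF.
Qed.

(** Strong induction on the column: in [(B *m A) i j = 0] with [j < i], the terms left of column [j]
    vanish by induction and those right of it because [A] is upper triangular, which leaves
    [B i j * A j j = 0]. *)
Lemma pos_upperV n (A : 'M[R]_n) : pos_upper A -> pos_upper (invmx A).
Proof.
move=> pA; have Au := pos_upper_unitmx pA; case: pA => upA A0.
set B := invmx A; have BA : B *m A = 1%:M by rewrite mulVmx.
have upB : upper_mx B.
  apply/upper_mxP => i j ji; have [m] := ubnP j.
  elim: m j ji => // m IH j ji jm.
  have /matrixP/(_ i j) := BA; rewrite !mxE (bigD1 j)//= big1 => [|k kj].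
    rewrite addr0 -[i == j]/(_ == _ :> nat) gtn_eqF// => /eqP.
    by rewrite mulf_eq0 (gt_eqF (A0 j)) orbF => /eqP.
  have [jk|kj'|/val_inj ejk] := ltngtP j k; last by rewrite ejk eqxx in kj.
    by move/upper_mxP : upA => ->; rewrite ?mulr0.
  by rewrite (IH k) ?mul0r ?(ltn_trans kj' ji) ?(leq_trans kj' jm).
split=> // i; have /matrixP/(_ i i) := BA.
rewrite upper_mxM_diag// mxE eqxx => BA1.
by rewrite -(pmulr_lgt0 _ (A0 i)) BA1 ltr01.
Qed.

Lemma unit_lower_tr n (A : 'M[R]_n) : unit_lower A -> pos_upper A^T.
Proof.
by move=> [lA A1]; split=> [|i]; rewrite /upper_mx/= ?trmxK// mxE A1.
Qed.

Lemma unit_lower_unitmx n (A : 'M[R]_n) : unit_lower A -> A \in unitmx.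
Proof. by move/unit_lower_tr/pos_upper_unitmx; rewrite unitmx_tr. Qed.

Definition schur n (A : 'M[R]_(1 + n)) : 'M[R]_n :=
  drsubmx A - (A 0 0)^-1 *: (dlsubmx A *m ursubmx A).

(* Junk unless all the pivots are nonzero. *)
Fixpoint luL n : 'M[R]_n -> 'M[R]_n :=
  match n with
  | 0%N => fun _ => 0
  | n'.+1 => fun A : 'M[R]_(1 + n') =>
      block_mx 1%:M 0 ((A 0 0)^-1 *: dlsubmx A) (luL (schur A))
  end.

(** By [luLP] and [pivots_gt0_mul], this characterizes the products of a unit lower and a positive
    upper triangular matrix. The recursion exhibits it as finitely many strict inequalities, hence
    as an open condition. *)
Fixpoint pivots_gt0 n : 'M[R]_n -> Prop :=
  match n with
  | 0%N => fun _ => True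
  | n'.+1 => fun A : 'M[R]_(1 + n') => 0 < A 0 0 /\ pivots_gt0 (schur A)
  end.

Lemma luL_unit_lower n (A : 'M[R]_n) : unit_lower (luL A).
Proof.
elim: n A => [A|n IH A /=]; first by split=> [|[] //]; apply/is_trig_mxP => -[].
have [lo di] := IH (schur A); split.
  rewrite (@is_trig_block_mx _ 1 n 1 n)//.
  by rewrite eqxx lo andbT /= mx11_is_trig.
move=> i; case: (@split_ordP 1 n i) => j ->.
  by rewrite (@block_mxEul _ 1 n 1 n) ord1 mxE.
by rewrite (@block_mxEdr _ 1 n 1 n) di.
Qed.

Lemma pos_upper_block n (a : R) (b : 'rV[R]_n) (U : 'M[R]_n) :
  0 < a -> pos_upper U -> pos_upper (block_mx a%:M b 0 U : 'M[R]_(1 + n)).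
Proof.
move=> a0 [upU U0]; split.
  by rewrite /upper_mx/= tr_block_mx is_trig_block_mx//= trmx0 eqxx mx11_is_trig.
move=> i; case: (@split_ordP 1 n i) => j ->; first by rewrite block_mxEul mxE eqxx.
by rewrite block_mxEdr.
Qed.

Lemma mx_block1 n (A : 'M[R]_(1 + n)) :
  A = block_mx (A 0 0)%:M (ursubmx A) (dlsubmx A) (drsubmx A).
Proof.
rewrite -{1}[A]submxK [ulsubmx A]mx11_scalar; congr (block_mx _%:M _ _ _).
by rewrite mxE mxE; congr (A _ _); apply/val_inj.
Qed.

(** One step of Gaussian elimination: the first column is divided by the pivot, and what remains to
    be factored is the Schur complement. *)
Lemma luLP n (A : 'M[R]_n) :
  pivots_gt0 A -> exists2 U, pos_upper U & A = luL A *m U.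
Proof.
elim: n A => [A _|n IH].
  by exists 0; [split=> [|[] //]; apply/is_trig_mxP => -[] | apply/matrixP => -[]].
rewrite -[n.+1]/(1 + n)%N => A [a0 /IH [U pU AU]].
exists (block_mx (A 0 0)%:M (ursubmx A) 0 U : 'M[R]_(1 + n)).
  exact: pos_upper_block.
rewrite {1}(mx_block1 A) (@mulmx_block _ 1 n 1 n 1 n).
rewrite !mul1mx !mul0mx !mulmx0 !addr0 -AU -!scalemxAl.
rewrite mul_mx_scalar scalerA mulVf ?gt_eqF// scale1r.
by rewrite /schur addrC subrK.
Qed.

Lemma unit_lower_sub n (L : 'M[R]_(1 + n)) :
  unit_lower L -> unit_lower (drsubmx L).
Proof.
move=> [loL L1]; split; last by move=> i; rewrite !mxE L1.
by apply/is_trig_mxP => i j ij; rewrite !mxE (is_trig_mxP loL).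
Qed.

Lemma upper_mx_sub n (U : 'M[R]_(1 + n)) : upper_mx U -> upper_mx (drsubmx U).
Proof.
move=> /upper_mxP upU; apply/upper_mxP => i j ij.
by rewrite !mxE upU.
Qed.

Lemma unit_lower_block n (L : 'M[R]_(1 + n)) : unit_lower L ->
  L = block_mx 1%:M 0 (dlsubmx L) (drsubmx L).
Proof.
move=> [loL L1]; rewrite {1}(mx_block1 L) L1; congr block_mx.
by apply/matrixP => i j; rewrite !mxE (is_trig_mxP loL)// ord1.
Qed.

Lemma mulmx_block1 n (L U : 'M[R]_(1 + n)) : unit_lower L -> upper_mx U ->
  L *m U = block_mx (U 0 0)%:M (ursubmx U) (U 0 0 *: dlsubmx L)
    (dlsubmx L *m ursubmx U + drsubmx L *m drsubmx U).
Proof.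
move=> uL /upper_mxP upU.
rewrite {1}(unit_lower_block uL) {1}(mx_block1 U) (@mulmx_block _ 1 n 1 n 1 n).
have -> : dlsubmx U = 0.
  by apply/matrixP => i j; rewrite !mxE upU//= ord1.
by rewrite !mul1mx !mul0mx !mulmx0 !addr0 mul_mx_scalar.
Qed.

Lemma mulmx00 n (L U : 'M[R]_(1 + n)) : unit_lower L -> upper_mx U ->
  (L *m U) 0 0 = U 0 0.
Proof.
move=> uL upU; rewrite mulmx_block1// (_ : 0 = lshift n 0 :> 'I_(1 + n)).
  by rewrite block_mxEul mxE eqxx.
exact/val_inj.
Qed.

Lemma schur_mul n (L U : 'M[R]_(1 + n)) : unit_lower L -> upper_mx U ->
  U 0 0 != 0 -> schur (L *m U) = drsubmx L *m drsubmx U.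
Proof.
move=> uL upU U0; rewrite /schur mulmx00// mulmx_block1//.
rewrite block_mxKdr block_mxKdl block_mxKur -scalemxAl scalerA mulVf//.
by rewrite scale1r addrC addKr.
Qed.

(** Uniqueness of the LU factorization: the first column of [L *m U] is that of [L] scaled by
    [U 0 0], and its Schur complement is the product of the trailing blocks, to which induction
    applies. *)
Lemma luL_mul n (L U : 'M[R]_n) : unit_lower L -> upper_mx U ->
  (forall i, U i i != 0) -> luL (L *m U) = L.
Proof.
elim: n L U => [L U _ _ _|n IH L U uL upU U0]; first by apply/matrixP => -[].
rewrite [LHS]/= (@schur_mul n)// IH; first last.
- by move=> i; rewrite !mxE U0.
- exact: upper_mx_sub.
- exact: unit_lower_sub.
rewrite (@mulmx00 n)// (@mulmx_block1 n)// block_mxKdl scalerA mulVf//.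
by rewrite scale1r -(@unit_lower_block n).
Qed.

Lemma pivots_gt0_mul n (L U : 'M[R]_n) :
  unit_lower L -> pos_upper U -> pivots_gt0 (L *m U).
Proof.
elim: n L U => // n IH L U uL [upU U0] /=.
rewrite (@mulmx00 n)// (@schur_mul n) ?gt_eqF//; split=> //.
apply: IH; first exact: unit_lower_sub.
by split=> [|i]; [exact: upper_mx_sub|rewrite !mxE U0].
Qed.

(** The Schur complement of a positive definite matrix is positive definite: its quadratic form at
    [y] is that of [G] at a suitable extension of [y]. *)
Lemma posdef_pivots n (G : 'M[R]_n) : G^T = G ->
  (forall x : 'cV_n, x != 0 -> 0 < (x^T *m G *m x) 0 0) -> pivots_gt0 G.
Proof.
elim: n G => // n IH; rewrite -[n.+1]/(1 + n)%N => G Gsym Gpos.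
have Gur : (ursubmx G)^T = dlsubmx G by rewrite trmx_ursub Gsym.
have a0 : 0 < G 0 0.
  have := Gpos (delta_mx 0 0); rewrite trmx_delta -rowE -colE !mxE; apply.
  apply/eqP => /matrixP/(_ 0 0)/eqP; rewrite !mxE eqxx/=.
  by rewrite oner_eq0.
split=> //; apply: IH => [|y y0].
  rewrite /schur linearB linearZ /= trmx_mul -Gur trmxK.
  by rewrite trmx_drsub Gsym.
(* The first coordinate is chosen so that the first entry of [G *m x] vanishes; it minimizes the
   form of [G] for given [y]. *)
pose x : 'cV_(1 + n) := col_mx (- (G 0 0)^-1 *: (ursubmx G *m y)) y.
have x0 : x != 0.
  by apply: contra_neq y0 => /(congr1 dsubmx); rewrite col_mxKd linear0.
have := Gpos _ x0; congr (0 < _ 0 0).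
rewrite {1}(mx_block1 G) /x tr_col_mx (@mul_row_block _ 1 1 n 1 n).
rewrite (@mul_row_col _ 1 1 n 1) -Gur !mul_mx_scalar.
rewrite !linearZ/= !trmx_mul /schur -Gur.
rewrite mulmxBr mulmxBl !mulmxDl -!scalemxAl -!scalemxAr !mulmxA.
rewrite scalerA mulNr mulVf ?gt_eqF// -!scalemxAl scaleN1r addNr scaler0 add0r.
by rewrite scaleNr addrC.
Qed.

End TriangularFactorization.

(** * Gram-Schmidt orthonormalization obtained from the LU factorization of the Gram matrix *)

Section GramSchmidt.
Variables (R : realType) (n : nat).
Implicit Types A Q : 'M[R]_n.

(* If [A = Q U] then [A^T A = U^T U = l D^2 l^T] with [D] the diagonal of [U] and
   [U = D l^T], so that [A l^-T = Q D], whose columns only need normalizing. *)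
Definition gs_mx A : 'M[R]_n :=
  let B := A *m invmx (luL (A^T *m A))^T in
  \matrix_(i, j) (B i j / Num.sqrt ((B^T *m B) j j)).

Lemma orthogonal_unitmx Q : orthogonal_mx Q -> Q \in unitmx.
Proof. by move=> /(mulmx1_unit (B := Q)) []. Qed.

Lemma orthogonal_mulmxT Q : orthogonal_mx Q -> Q *m Q^T = 1%:M.
Proof. exact: mulmx1C. Qed.

Lemma orthogonal_mxM P Q :
  orthogonal_mx P -> orthogonal_mx Q -> orthogonal_mx (P *m Q).
Proof.
rewrite /orthogonal_mx/= => P1 Q1.
by rewrite trmx_mul mulmxA -[_ *m P^T *m _]mulmxA P1 mulmx1.
Qed.

Lemma sqr_cV_gt0 (x : 'cV[R]_n) : x != 0 -> 0 < (x^T *m x) 0 0.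
Proof.
move=> x0; rewrite mxE lt0r sumr_ge0 ?andbT => [|i _]; last first.
  by rewrite mxE -expr2 sqr_ge0.
apply: contra_neq x0; move=> /psumr_eq0P x0.
apply/matrixP => i j; rewrite ord1 mxE; apply/eqP; rewrite -sqrf_eq0 expr2.
by have := x0 _ i isT; rewrite mxE => -> // k _; rewrite mxE -expr2 sqr_ge0.
Qed.

Lemma gram_pivots A : A \in unitmx -> pivots_gt0 (A^T *m A).
Proof.
move=> Au; apply: posdef_pivots; first by rewrite trmx_mul trmxK.
move=> x x0; rewrite mulmxA -trmx_mul -mulmxA; apply: sqr_cV_gt0.
by apply: contra_neq x0 => /(congr1 (mulmx (invmx A))); rewrite mulKmx// mulmx0.
Qed.

Lemma gs_mxP A : A \in unitmx ->
  orthogonal_mx (gs_mx A) /\ exists2 U, pos_upper U & A = gs_mx A *m U.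
Proof.
move=> Au; have [U pU AU] := luLP (gram_pivots Au).
rewrite /gs_mx; have ul := luL_unit_lower (A^T *m A).
move: (luL _) ul AU => l ul AU.
have pl := unit_lower_tr ul; have lu := unit_lower_unitmx ul.
have ltu : l^T \in unitmx by rewrite unitmx_tr.
have [B eB] : exists B, B = A *m invmx l^T by eexists.
rewrite -eB.
have BB : B^T *m B = U *m invmx l^T.
  rewrite eB trmx_mul trmx_inv trmxK mulmxA -[_ *m A^T *m A]mulmxA AU.
  by rewrite mulKmx.
(* The Gram matrix of [B] is both upper triangular and symmetric, so it is diagonal: the columns of
   [B] are orthogonal. *)
have [upBB BB0] : pos_upper (B^T *m B).
  by rewrite BB; apply: pos_upperM => //; exact: pos_upperV.
have BBdiag i j : (B^T *m B) i j = (B^T *m B) i i *+ (i == j).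
  have [->//|ij] := eqVneq i j; rewrite mulr0n.
  have Bsym : (B^T *m B)^T = B^T *m B by rewrite trmx_mul trmxK.
  move/upper_mxP : upBB => up.
  move: ij; rewrite -val_eqE neq_ltn => /orP[ij|/up//].
  by rewrite -Bsym mxE up.
set D := fun i => Num.sqrt ((B^T *m B) i i).
have D0 i : 0 < D i by rewrite sqrtr_gt0.
set Q := \matrix_(i, j) _.
have QE i j : Q i j = B i j / D j by rewrite [LHS]mxE.
move: Q QE => Q QE; split.
  apply/matrixP => i j; rewrite mxE [RHS]mxE.
  transitivity ((B^T *m B) i j / (D i * D j)).
    rewrite [(B^T *m B) i j]mxE mulr_suml; apply: eq_bigr => k _.
    by rewrite !mxE !QE invfM mulrACA.
  rewrite BBdiag; have [->|ij] := eqVneq i j; last by rewrite mulr0n mul0r.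
  by rewrite mulr1n -expr2 sqr_sqrtr ?divff ?gt_eqF ?ltW.
exists (\matrix_(i, j) (D i * l^T i j)).
  split=> [|i]; last by rewrite mxE mulr_gt0//; case: pl.
  by apply/upper_mxP => i j ij; rewrite mxE; move/upper_mxP : pl.1 => ->; rewrite ?mulr0.
rewrite -[LHS](mulmxKV ltu) -eB; apply/matrixP => i j; rewrite !mxE.
by apply: eq_bigr => k _; rewrite !mxE QE mulrA divfK// gt_eqF.
Qed.

(** Uniqueness of the QR factorization. The Gram matrix is [U^T *m U], and splitting off the
    diagonal [D] of [U] as [U^T = l D] turns this into the LU factorization [l (D U)], from which
    [luL] reads off [l]. *)
Lemma gs_mx_mul Q U : orthogonal_mx Q -> pos_upper U -> gs_mx (Q *m U) = Q.
Proof.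
move=> Q1 pU; have Uu := pos_upper_unitmx pU; have [upU U0] := pU.
pose D := \row_j U j j.
pose l := U^T *m diag_mx (map_mx GRing.inv D).
have ul : unit_lower l.
  split=> [|i]; last by rewrite /l mul_mx_diag !mxE mulfV ?gt_eqF.
  apply/is_trig_mxP => i j ij; rewrite /l mul_mx_diag !mxE.
  by move/upper_mxP : upU => ->//; rewrite mul0r.
have lD : l *m diag_mx D = U^T.
  apply/matrixP => i j; rewrite /l !mul_mx_diag !mxE mulfVK//.
  by rewrite gt_eqF.
have eG : (Q *m U)^T *m (Q *m U) = l *m (diag_mx D *m U).
  by rewrite [RHS]mulmxA lD trmx_mul mulmxA -[_ *m Q^T *m Q]mulmxA Q1 mulmx1.
have el : luL ((Q *m U)^T *m (Q *m U)) = l.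
  rewrite eG luL_mul//.
    apply/upper_mxP => i j ij; rewrite mul_diag_mx !mxE.
    by rewrite ((upper_mxP U).1 upU i j ij) mulr0.
  by move=> i; rewrite mul_diag_mx !mxE mulf_neq0 ?gt_eqF.
have eB : Q *m U *m invmx l^T = Q *m diag_mx D.
  have ltu : l^T \in unitmx by rewrite unitmx_tr unit_lower_unitmx.
  by rewrite -[LHS]mulmxA -[U]trmxK -lD trmx_mul tr_diag_mx mulmxK.
rewrite /gs_mx el eB; apply/matrixP => i j; rewrite [LHS]mxE.
rewrite trmx_mul tr_diag_mx mulmxA -[_ *m Q^T *m Q]mulmxA Q1 mulmx1.
rewrite mul_mx_diag mul_diag_mx !mxE eqxx mulr1n -expr2 sqrtr_sqr gtr0_norm//.
by rewrite mulfK ?gt_eqF.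
Qed.

End GramSchmidt.

(** * Smoothness of functions built from coordinates by field operations and square roots *)

Section NearDifferentiable.
Variables (R : realType) (V W : normedModType R).

(** Iterated derivatives will be known to agree with elementary maps on an open set only, so
    differentiability has to be transferred along germs. *)
Lemma near_eq_differentiable (f g : V -> W) (x : V) :
  (\near x, f x = g x) -> differentiable f x -> differentiable g x.
Proof.
move=> fg df; have /diff_locallyP [cdf] := df => /eqaddoP fo.
suff go : g \o shift x = cst (g x) + 'd f x +o_ 0 id.
  by apply/diff_locallyP; rewrite (diff_unique cdf go).
apply/eqaddoP => e e0; have := fo _ e0.
have /= fgx : \forall h \near 0, f (h + x) = g (h + x).
  by have := fg; rewrite (near_shift 0) /=; apply: filterS => h; rewrite subr0.
apply: filter_app; apply: filterS fgx => h /= fgh.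
by rewrite !fctE/= fgh (nbhs_singleton fg).
Qed.

End NearDifferentiable.

Section ElementaryFunctions.
Variables (R : realType) (p q : nat).
Local Notation V := 'M[R]_(p, q).

(* The coordinates generate, under field operations and square roots that are
   defined throughout [X], a class closed under directional derivatives, hence
   consisting of smooth functions. *)
Inductive elementary (X : set V) : (V -> R) -> Prop :=
| elementary_cst c : elementary X (fun=> c)
| elementary_coord i j : elementary X (fun x => x i j)
| elementaryD f g : elementary X f -> elementary X g ->
    elementary X (fun x => f x + g x)
| elementaryM f g : elementary X f -> elementary X g ->
    elementary X (fun x => f x * g x)
| elementaryV f : (forall x, X x -> f x != 0) -> elementary X f ->
    elementary X (fun x => (f x)^-1)
| elementary_sqrt f : (forall x, X x -> 0 < f x) -> elementary X f ->
    elementary X (fun x => Num.sqrt (f x)).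

Definition elementary_mx (X : set V) m n (F : V -> 'M[R]_(m, n)) :=
  forall i j, elementary X (fun x => F x i j).

Lemma elementary_sub (X Y : set V) f :
  Y `<=` X -> elementary X f -> elementary Y f.
Proof.
move=> YX; elim=> [c|i j|g h _ Eg _ Eh|g h _ Eg _ Eh|g g0 _ Eg|g g0 _ Eg].
- exact: elementary_cst.
- exact: elementary_coord.
- exact: elementaryD.
- exact: elementaryM.
- by apply: elementaryV => // x /YX; exact: g0.
- by apply: elementary_sqrt => // x /YX; exact: g0.
Qed.

Lemma is_derive_coord i j (x v : V) : is_derive x v (fun y : V => y i j : R) (v i j).
Proof.
apply: DeriveDef; first exact/diff_derivable/differentiable_coord.
have dx : derivable (@id V) x v by exact: derivable_id.
by have /matrixP/(_ i j) := derive_mx dx; rewrite derive_id mxE => ->.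
Qed.

Lemma elementary_differentiable X f :
  elementary X f -> forall x, X x -> differentiable f x.
Proof.
elim=> [c|i j|g h _ Eg _ Eh|g h _ Eg _ Eh|g g0 _ Eg|g g0 _ Eg] x Xx.
- exact: differentiable_cst.
- exact: differentiable_coord.
- by apply: differentiableD; [exact: Eg|exact: Eh].
- by apply: differentiableM; [exact: Eg|exact: Eh].
- by apply: differentiableV; [exact: Eg|exact: g0].
- apply: (@differentiable_comp _ _ _ _ g); first exact: Eg.
  by apply/derivable1_diffP; have [] := is_derive1_sqrt (g0 _ Xx).
Qed.

(** Each differentiation rule stays inside the class: an inverse or a square root reappears in its
    own derivative under the same condition on [X]. *)
Lemma elementary_derive X f v : elementary X f ->
  exists2 g, elementary X g & forall x, X x -> is_derive x v f (g x).
Proof.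
elim=> [c|i j|g h Eg [g' Eg' gg'] Eh [h' Eh' hh']
  |g h Eg [g' Eg' gg'] Eh [h' Eh' hh']|g g0 Eg [g' Eg' gg']
  |g g0 Eg [g' Eg' gg']].
- exists (fun=> 0); first exact: elementary_cst.
  by move=> x _; exact: is_derive_cst.
- exists (fun=> v i j); first exact: elementary_cst.
  by move=> x _; exact: is_derive_coord.
- exists (fun x => g' x + h' x); first exact: elementaryD.
  by move=> x Xx; apply: is_deriveD; [exact: gg'|exact: hh'].
- exists (fun x => g x * h' x + h x * g' x).
    by apply: elementaryD; exact: elementaryM.
  by move=> x Xx; apply: is_deriveM; [exact: gg'|exact: hh'].
- exists (fun x => - 1 * ((g x)^-1 * (g x)^-1) * g' x).
    apply: elementaryM => //; apply: elementaryM; first exact: elementary_cst.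
    by apply: elementaryM; exact: elementaryV.
  move=> x Xx; have [dg dgE] := gg' _ Xx.
  apply: DeriveDef; first by apply: derivableV => //; exact: g0.
  by rewrite deriveV ?g0// dgE -expr2 exprVn mulN1r.
- exists (fun x => (2 * Num.sqrt (g x))^-1 * g' x).
    apply: elementaryM => //; apply: elementaryV.
      by move=> x Xx; rewrite mulf_neq0// gt_eqF// sqrtr_gt0 g0.
    by apply: elementaryM; [exact: elementary_cst|exact: elementary_sqrt].
  move=> x Xx.
  (* The chain rule requires [g] to be differentiable, not merely derivable along [v]. *)
  have dg := elementary_differentiable Eg Xx.
  have dsqrt : differentiable (Num.sqrt : R -> R) (g x).
    by apply/derivable1_diffP; have [] := is_derive1_sqrt (g0 _ Xx).
  apply: DeriveDef.
    by apply/diff_derivable; exact: (@differentiable_comp _ _ _ _ g).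
  rewrite deriveE; last exact: (@differentiable_comp _ _ _ _ g).
  have [_ <-] := gg' _ Xx.
  rewrite (diff_comp dg dsqrt)/= deriveE// diff1E//= mulrC derive1E.
  by rewrite derive_sqrt// g0.
Qed.

Lemma elementary_continuous X f : elementary X f ->
  forall x, X x -> {for x, continuous f}.
Proof.
by move=> Ef x Xx; exact/differentiable_continuous/(elementary_differentiable Ef).
Qed.

Lemma open_elementary_gt0 X f : open X -> elementary X f ->
  open [set x | X x /\ 0 < f x].
Proof.
move=> oX Ef; rewrite openE => x [Xx fx0].
have fc := elementary_continuous Ef Xx.
apply: filterS2 (open_nbhs_nbhs (conj oX Xx)) (cvgr_gt _ fc _ fx0) => y.
by [].
Qed.

Variables (m n : nat).
Implicit Types F : V -> 'M[R]_(m, n).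

Lemma elementary_mx_differentiable X F :
  elementary_mx X F -> forall x, X x -> differentiable F x.
Proof.
move=> EF x Xx.
have -> : F = \sum_(i < m) \sum_(j < n) (fun y => F y i j *: delta_mx i j).
  apply/funext => y; rewrite [LHS]matrix_sum_delta fct_sumE.
  by apply: eq_bigr => i _; rewrite fct_sumE.
apply: differentiable_sum => i; apply: differentiable_sum => j.
exact/differentiableZl/(elementary_differentiable (EF i j)).
Qed.

Lemma elementary_mx_derive X F v : elementary_mx X F ->
  exists2 G, elementary_mx X G & forall x, X x -> 'D_v F x = G x.
Proof.
move=> EF.
have /choice[G GP] (ij : 'I_m * 'I_n) : exists g, elementary X g /\
    forall x, X x -> is_derive x v (fun x => F x ij.1 ij.2) (g x).
  by have [g Eg ?] := elementary_derive v (EF ij.1 ij.2); exists g.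
exists (fun x => \matrix_(i, j) G (i, j) x).
  move=> i j; have [EG _] := GP (i, j).
  by have -> : (fun x => (\matrix_(i, j) G (i, j) x) i j) = G (i, j)
    by apply/funext => x; rewrite mxE.
move=> x Xx; rewrite derive_mx.
  apply/matrixP => i j; rewrite !mxE; have [_ FG] := GP (i, j).
  by apply: derive_val; exact: FG.
exact/diff_derivable/(elementary_mx_differentiable EF).
Qed.

(** Induction on the list of directions shows that every iterated derivative agrees on [X] with an
    elementary map; openness of [X] lets this equality be differentiated once more. *)
Lemma elementary_mx_smooth X F : open X -> elementary_mx X F -> smooth X F.
Proof.
move=> oX EF vs.
have [G EG FG] : exists2 G, elementary_mx X G & forall x, X x ->
    foldr (fun v (g : V -> 'M[R]_(m, n)) => 'D_v g) F vs x = G x.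
  elim: vs => [|v vs [G EG FG]]; first by exists F.
  have [H EH GH] := elementary_mx_derive v EG; exists H => // x Xx.
  rewrite /= -GH//; apply: near_eq_derive.
  by apply: filterS (open_nbhs_nbhs (conj oX Xx)) => y /FG.
move=> x Xx; apply: (@near_eq_differentiable _ _ _ G).
  by apply: filterS (open_nbhs_nbhs (conj oX Xx)) => y /FG.
exact: elementary_mx_differentiable EG _ Xx.
Qed.

End ElementaryFunctions.

Section ElementaryMatrices.
Variables (R : realType) (p q : nat) (X : set 'M[R]_(p, q)).
Local Notation V := 'M[R]_(p, q).

Lemma elementaryN f : elementary X f -> elementary X (fun x => - f x).
Proof.
move=> Ef; under eq_fun do rewrite -mulN1r.
by apply: elementaryM => //; exact: elementary_cst.
Qed.

Lemma elementary_sum I (r : seq I) (f : I -> V -> R) :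
  (forall i, elementary X (f i)) ->
  elementary X (fun x => \sum_(i <- r) f i x).
Proof.
move=> Ef; elim: r => [|i r IH].
  by under eq_fun do rewrite big_nil; exact: elementary_cst.
by under eq_fun do rewrite big_cons; exact: elementaryD.
Qed.

Lemma elementary_prod I (r : seq I) (f : I -> V -> R) :
  (forall i, elementary X (f i)) ->
  elementary X (fun x => \prod_(i <- r) f i x).
Proof.
move=> Ef; elim: r => [|i r IH].
  by under eq_fun do rewrite big_nil; exact: elementary_cst.
by under eq_fun do rewrite big_cons; exact: elementaryM.
Qed.

Lemma elementary_mx_cst m n (A : 'M[R]_(m, n)) : elementary_mx X (fun=> A).
Proof. by move=> i j; exact: elementary_cst. Qed.

Lemma elementary_mx_id : elementary_mx X id.
Proof. by move=> i j; exact: elementary_coord. Qed.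

Lemma elementary_mx_tr m n (F : V -> 'M[R]_(m, n)) :
  elementary_mx X F -> elementary_mx X (fun x => (F x)^T).
Proof. by move=> EF i j; under eq_fun do rewrite mxE; exact: EF. Qed.

Lemma elementary_mxD m n (F G : V -> 'M[R]_(m, n)) :
  elementary_mx X F -> elementary_mx X G -> elementary_mx X (fun x => F x + G x).
Proof.
move=> EF EG i j; under eq_fun do rewrite mxE.
by apply: elementaryD; [exact: EF|exact: EG].
Qed.

Lemma elementary_mxZ m n f (F : V -> 'M[R]_(m, n)) :
  elementary X f -> elementary_mx X F -> elementary_mx X (fun x => f x *: F x).
Proof.
move=> Ef EF i j; under eq_fun do rewrite mxE.
by apply: elementaryM => //; exact: EF.
Qed.

Lemma elementary_mxM m n k (F : V -> 'M[R]_(m, n)) (G : V -> 'M[R]_(n, k)) :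
  elementary_mx X F -> elementary_mx X G -> elementary_mx X (fun x => F x *m G x).
Proof.
move=> EF EG i j; under eq_fun do rewrite mxE.
by apply: elementary_sum => l; apply: elementaryM; [exact: EF|exact: EG].
Qed.

Lemma elementary_row_perm m n (s : 'S_m) (F : V -> 'M[R]_(m, n)) :
  elementary_mx X F -> elementary_mx X (fun x => row_perm s (F x)).
Proof. by move=> EF i j; under eq_fun do rewrite mxE; exact: EF. Qed.

Lemma elementary_det n (F : V -> 'M[R]_n) :
  elementary_mx X F -> elementary X (fun x => \det (F x)).
Proof.
move=> EF; apply: elementary_sum => s; apply: elementaryM.
  exact: elementary_cst.
by apply: elementary_prod => i; exact: EF.
Qed.

(** Cramer's rule: the adjugate is polynomial in the entries. *)
Lemma elementary_mxV n (F : V -> 'M[R]_n) : elementary_mx X F ->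
  (forall x, F x \in unitmx) -> elementary_mx X (fun x => invmx (F x)).
Proof.
move=> EF Fu; have -> : (fun x => invmx (F x)) =
    (fun x => (\det (F x))^-1 *: \adj (F x)).
  by apply/funext => x; rewrite /invmx Fu.
apply: elementary_mxZ.
  apply: elementaryV; last exact: elementary_det.
  by move=> x _; rewrite -unitfE -unitmxE.
move=> i j; under eq_fun do rewrite mxE.
apply: elementaryM; first exact: elementary_cst.
apply: elementary_det => k l; under eq_fun do rewrite !mxE; exact: EF.
Qed.

Lemma elementary_horner_mx n (F : V -> 'M[R]_n.+1) (P : {poly R}) :
  elementary_mx X F -> elementary_mx X (fun x => horner_mx (F x) P).
Proof.
move=> EF; elim/poly_ind: P => [|P c IH].
  by under eq_fun do rewrite rmorph0; exact: elementary_mx_cst.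
under eq_fun do rewrite rmorphD rmorphM /= horner_mx_X horner_mx_C.
apply: elementary_mxD; last exact: elementary_mx_cst.
exact: elementary_mxM.
Qed.

End ElementaryMatrices.

(** * Smoothness of the LU and Gram-Schmidt factors *)

Section ElementaryGramSchmidt.
Variables (R : realType) (p q : nat).
Local Notation V := 'M[R]_(p, q).

Lemma elementary_mx_block m1 m2 n1 n2 (X : set V) (A : V -> 'M[R]_(m1, n1))
    (B : V -> 'M[R]_(m1, n2)) (C : V -> 'M[R]_(m2, n1)) (D : V -> 'M[R]_(m2, n2)) :
  elementary_mx X A -> elementary_mx X B -> elementary_mx X C ->
  elementary_mx X D ->
  elementary_mx X (fun x => block_mx (A x) (B x) (C x) (D x)).
Proof.
move=> EA EB EC ED i j.
case: (split_ordP i) => i' ->; case: (split_ordP j) => j' ->.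
- by under eq_fun do rewrite block_mxEul; exact: EA.
- by under eq_fun do rewrite block_mxEur; exact: EB.
- by under eq_fun do rewrite block_mxEdl; exact: EC.
- by under eq_fun do rewrite block_mxEdr; exact: ED.
Qed.

(** Induction with a shrinking domain: positivity of the current pivot cuts out the open set [Y], on
    which the inverse of the pivot, and with it the Schur complement, is elementary. *)
Lemma elementary_luL n (X : set V) (F : V -> 'M[R]_n) :
    open X -> elementary_mx X F ->
  open (X `&` [set x | pivots_gt0 (F x)]) /\
  elementary_mx (X `&` [set x | pivots_gt0 (F x)]) (fun x => luL (F x)).
Proof.
elim: n X F => [X F oX _|n IH X F oX EF].
  by rewrite (_ : [set x | _] = setT) ?setIT//; split=> // -[].
pose Y := [set x | X x /\ 0 < F x 0 0].
have oY : open Y by apply: open_elementary_gt0 => //; exact: EF.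
have YX : Y `<=` X by move=> x [].
have EFY i j : elementary Y (fun x => F x i j).
  exact: elementary_sub YX (EF i j).
have EV : elementary Y (fun x => (F x 0 0)^-1).
  by apply: elementaryV => // x [_ /gt_eqF ->].
have Edl : elementary_mx Y (fun x => dlsubmx (F x : 'M[R]_(1 + n))).
  move=> i j; have -> : (fun x => dlsubmx (F x : 'M[R]_(1 + n)) i j) =
    (fun x => F x (rshift 1 i) (lshift n j)) by apply/funext => x; rewrite !mxE.
  exact: EFY.
have ES : elementary_mx Y (fun x => schur (F x : 'M[R]_(1 + n))).
  apply: elementary_mxD => [i j|]; first by under eq_fun do rewrite !mxE.
  pose G x : 'M[R]_(1 + n) := F x.
  have -> : (fun x => - ((F x 0 0)^-1 *: (dlsubmx (G x) *m ursubmx (G x)))) =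
      (fun x => (- 1 * (F x 0 0)^-1) *: (dlsubmx (G x) *m ursubmx (G x))).
    by apply/funext => x; rewrite mulN1r scaleNr.
  apply: elementary_mxZ; first exact/elementaryM/EV/elementary_cst.
  by apply: elementary_mxM => i j; under eq_fun do rewrite !mxE.
have [oZ EL] := IH Y _ oY ES.
have -> : X `&` [set x | pivots_gt0 (F x)] =
    Y `&` [set x | pivots_gt0 (schur (F x : 'M[R]_(1 + n)))].
  by apply/seteqP; split=> x /=; rewrite /Y/=; tauto.
split=> //.
have subY : Y `&` [set x | pivots_gt0 (schur (F x : 'M[R]_(1 + n)))] `<=` Y.
  by move=> x [].
apply: (@elementary_mx_block 1 n 1 n); [exact: elementary_mx_cst..| |exact: EL].
apply: elementary_mxZ; first exact: elementary_sub subY EV.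
by move=> i j; apply: elementary_sub subY (Edl i j).
Qed.

Lemma elementary_gs n (X : set V) (F : V -> 'M[R]_n) : open X ->
  elementary_mx X F -> (forall x, F x \in unitmx) ->
  elementary_mx X (fun x => gs_mx (F x)).
Proof.
move=> oX EF Fu.
have EG : elementary_mx X (fun x => (F x)^T *m F x).
  by apply: elementary_mxM => //; exact: elementary_mx_tr.
have [_] := elementary_luL oX EG.
rewrite (_ : [set x | _] = setT) ?setIT => [EL|]; last first.
  by apply/seteqP; split=> // x _; exact: gram_pivots.
pose l x := luL ((F x)^T *m F x).
have ltu x : (l x)^T \in unitmx.
  by rewrite unitmx_tr; exact/unit_lower_unitmx/luL_unit_lower.
pose B x := F x *m invmx (l x)^T.
have EB : elementary_mx X B.
  by apply: elementary_mxM => //; apply: elementary_mxV => //; exact: elementary_mx_tr.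
move=> i j; rewrite /gs_mx; under eq_fun do rewrite mxE -/(B _).
apply: elementaryM; first exact: EB.
(* This is the squared norm of a column of the invertible matrix [B x]. *)
have BB0 x : 0 < ((B x)^T *m B x) j j.
  have -> : ((B x)^T *m B x) j j = ((col j (B x))^T *m col j (B x)) 0 0.
    by rewrite !mxE; apply: eq_bigr => k _; rewrite !mxE.
  apply: sqr_cV_gt0; rewrite colE.
  have Bu : B x \in unitmx by rewrite unitmx_mul Fu unitmx_inv ltu.
  apply/eqP => /(congr1 (mulmx (invmx (B x)))); rewrite mulKmx// mulmx0.
  move/matrixP => /(_ j 0)/eqP; rewrite !mxE !eqxx/=.
  by rewrite oner_eq0.
apply: elementaryV => [x _|]; first by rewrite gt_eqF// sqrtr_gt0.
apply: elementary_sqrt => [x _//|].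
by apply: elementary_mxM => //; exact: elementary_mx_tr.
Qed.

End ElementaryGramSchmidt.

(** * Uniqueness of integral curves of elementary vector fields *)

Section Uniqueness.
Variables (R : realType).

Lemma continuous_segment_bounded (f : R -> R) (a b : R) : a <= b ->
    (forall x, a <= x <= b -> {for x, continuous f}) ->
  exists2 K, 0 <= K & forall x, a <= x <= b -> `|f x| <= K.
Proof.
move=> ab fc.
have cf : {within `[a, b], continuous (fun x => `|f x|)}.
  apply: continuous_in_subspaceT => x; rewrite inE/= in_itv/= => /fc fx.
  exact: (continuous_comp fx (@norm_continuous _ _ _)).
have [c _ cmax] := EVT_max ab cf.
by exists `|f c| => // x xab; apply: cmax; rewrite in_itv.
Qed.

Lemma ler_mx_norm m n (A : 'M[R]_(m, n)) i j : `|A i j| <= `|A|.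
Proof.
by rewrite [leRHS]mx_normrE; exact: (le_bigmax _ (fun ij => `|A ij.1 ij.2|) (i, j)).
Qed.

(** The norm on matrices is the maximum norm; the sum of squares that dominates it has the advantage
    of being differentiable along curves. *)
Lemma sqr_mx_norm_le m n (A : 'M[R]_(m, n)) :
  `|A| ^+ 2 <= \sum_i \sum_j A i j ^+ 2.
Proof.
have S0 : 0 <= \sum_i \sum_j A i j ^+ 2.
  by do 2! (apply: sumr_ge0 => ? _); exact: sqr_ge0.
rewrite -[leRHS]sqr_sqrtr// ler_sqr ?nnegrE ?sqrtr_ge0//.
rewrite [leLHS]mx_normrE; apply: bigmax_le; first exact: sqrtr_ge0.
move=> [i j] _ /=; rewrite -sqrtr_sqr ler_wsqrtr//.
rewrite (bigD1 i)//= (bigD1 j)//= -addrA lerDl addr_ge0//.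
  by apply: sumr_ge0 => ? _; exact: sqr_ge0.
by do 2! (apply: sumr_ge0 => ? _); exact: sqr_ge0.
Qed.

(** Gronwall's inequality in both time directions: [e] times a suitable exponential is monotone
    between [s] and [t]. *)
Lemma gronwall0 (e : R -> R) (de : R -> R) (K s t : R) :
    (forall x, Num.min s t <= x <= Num.max s t ->
       is_derive x 1 e (de x) /\ `|de x| <= K * e x) ->
  e s = 0 -> e t <= 0.
Proof.
move=> eK es.
(* The sign makes [h] nonincreasing when [t] lies after [s] and nondecreasing when it lies before,
   so that [h t <= h s] in either case. *)
pose k := if s <= t then - K else K.
pose h x := e x * expR (k * x).
pose dh x := (de x + k * e x) * expR (k * x).
have hd x : Num.min s t <= x <= Num.max s t -> is_derive x 1 h (dh x).
  move=> /eK[ed _]; rewrite /h.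
  have kd : is_derive x 1 (fun y => expR (k * y)) (k * expR (k * x)).
    have kx : is_derive x 1 (fun y : R => k * y) k.
      by apply: (is_derive_eq (is_deriveZ k (is_derive_id x 1))); exact: mulr1.
    have /= := is_derive1_comp (is_derive_expR (k * x)) kx.
    by rewrite mulrC.
  apply: (is_derive_eq (is_deriveM ed kd)).
  by rewrite /dh /GRing.scale/=; ring.
suff : h t <= h s by rewrite /h es mul0r pmulr_lle0 ?expR_gt0.
have hc : {within `[Num.min s t, Num.max s t], continuous h}.
  apply: continuous_in_subspaceT => x; rewrite inE/= in_itv/= => /hd[hx _].
  exact/differentiable_continuous/derivable1_diffP.
have hdo x : x \in `]Num.min s t, Num.max s t[%R ->
    derivable h x 1 /\ h^`()%classic x = dh x.
  rewrite in_itv/= => /andP[x1 x2].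
  have [|hx hxE] := hd x; first by rewrite !ltW.
  by rewrite derive1E.
have emin : Num.min s t <= Num.max s t by rewrite le_max ge_min lexx.
have [st|ts] := leP s t.
  rewrite min_l// max_r// in hc hdo eK.
  apply: (ler0_derive1_nincr _ _ hc) => //.
  - by move=> x /hdo[].
  - move=> x xst; have [_ ->] := hdo x xst.
    have [|_] := eK x; first by move: xst; rewrite in_itv/= => /andP[? ?]; rewrite !ltW.
    rewrite /dh /k st ler_norml => /andP[_ de1].
    by rewrite pmulr_lle0 ?expR_gt0// mulNr subr_le0.
rewrite min_r ?max_l ?(ltW ts)// in hc hdo eK.
apply: (ger0_derive1_ndecr _ _ hc) => //; last exact: ltW.
- by move=> x /hdo[].
- move=> x xst; have [_ ->] := hdo x xst.
  have [|_] := eK x; first by move: xst; rewrite in_itv/= => /andP[? ?]; rewrite !ltW.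
  rewrite /dh /k (lt_geF ts) ler_norml => /andP[de1 _].
  by rewrite mulr_ge0 ?expR_ge0// -lerBlDr sub0r.
Qed.

Section Curves.
Variables (m n : nat).
Local Notation V := 'M[R]_(m, n).

Lemma is_derive_mxP (V' : normedModType R) (M : V' -> V) (x v : V') (dM : V) :
  is_derive x v M dM <->
  forall i j, is_derive x v (fun y => M y i j) (dM i j).
Proof.
split=> [[dM1 <-] i j|dM1].
  apply: DeriveDef; first exact: ((derivable_mxP M x v).1 dM1 i j).
  by rewrite derive_mx ?mxE.
have dMx : derivable M x v by apply/derivable_mxP => i j; have [] := dM1 i j.
apply: DeriveDef => //; rewrite derive_mx//; apply/matrixP => i j.
by rewrite mxE; have [_ ->] := dM1 i j.
Qed.

(** Elementary functions are bounded along continuous curves over a segment, and with such bounds a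
    Lipschitz estimate passes through each generating operation. *)
Lemma elementary_curve_lipschitz (M N : R -> V) (a b : R) (f : V -> R) :
    a <= b -> elementary setT f ->
    (forall x, a <= x <= b -> {for x, continuous M} /\ {for x, continuous N}) ->
  exists2 C, 0 <= C & forall x, a <= x <= b ->
    `|f (M x) - f (N x)| <= C * `|M x - N x|.
Proof.
move=> ab Ef MNc.
have bounded (h : V -> R) (P : R -> V) : elementary setT h ->
    (forall x, a <= x <= b -> {for x, continuous P}) ->
    exists2 K, 0 <= K & forall x, a <= x <= b -> `|h (P x)| <= K.
  move=> Eh Pc; apply: continuous_segment_bounded => // x /Pc Px.
  exact/(continuous_comp Px)/(elementary_continuous Eh).
have Mc x xab := (MNc x xab).1; have Nc x xab := (MNc x xab).2.
(* The hypothesis is duplicated so that [bounded] applies to the composite function too, in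
   particular to an inverse. *)
elim: Ef (Ef) => {f} [c|i j|g h Eg IHg Eh IHh|g h Eg IHg Eh IHh
  |g g0 Eg IHg|g g0 Eg IHg] Ef.
- by exists 0 => // x _; rewrite subrr normr0 mul0r.
- exists 1 => // x _; rewrite mul1r.
  by have := ler_mx_norm (M x - N x) i j; rewrite !mxE.
- have [C C0 gC] := IHg Eg; have [D D0 hD] := IHh Eh.
  exists (C + D) => [|x xab]; first exact: addr_ge0.
  rewrite opprD addrACA mulrDl (le_trans (ler_normD _ _))// lerD//.
    exact: gC.
  exact: hD.
- have [C C0 gC] := IHg Eg; have [D D0 hD] := IHh Eh.
  have [K K0 gK] := bounded _ _ Eg Mc; have [L L0 hL] := bounded _ _ Eh Nc.
  exists (K * D + L * C) => [|x xab]; first by rewrite addr_ge0// mulr_ge0.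
  have -> : g (M x) * h (M x) - g (N x) * h (N x) =
    g (M x) * (h (M x) - h (N x)) + h (N x) * (g (M x) - g (N x)) by ring.
  rewrite (le_trans (ler_normD _ _))// mulrDl !normrM -!mulrA lerD//.
    by rewrite ler_pM// ?gK// hD.
  by rewrite ler_pM// ?hL// gC.
- have [C C0 gC] := IHg Eg.
  have [K K0 gK] := bounded _ _ Ef Mc; have [L L0 gL] := bounded _ _ Ef Nc.
  exists (K * L * C) => [|x xab]; first by rewrite !mulr_ge0.
  have gM : g (M x) != 0 by exact: g0.
  have gN : g (N x) != 0 by exact: g0.
  have -> : (g (M x))^-1 - (g (N x))^-1 =
    - ((g (M x))^-1 * (g (N x))^-1 * (g (M x) - g (N x))).
    by field; rewrite gM gN.
  rewrite normrN !normrM -[leRHS]mulrA ler_pM//; last exact: gC.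
  by rewrite ler_pM// ?gK// gL.
- have [C C0 gC] := IHg Eg.
  (* The estimate is [|sqrt a - sqrt b| = |a - b| / (sqrt a + sqrt b) <= |a - b| / sqrt a], whose
     last factor has to be bounded. *)
  have EV : elementary setT (fun x => (Num.sqrt (g x))^-1).
    by apply: elementaryV => // x _; rewrite gt_eqF// sqrtr_gt0 g0.
  have [K K0 gK] := bounded _ _ EV Mc.
  exists (K * C) => [|x xab]; first exact: mulr_ge0.
  have gM : 0 < g (M x) by exact: g0.
  have gN : 0 < g (N x) by exact: g0.
  have sM : 0 < Num.sqrt (g (M x)) by rewrite sqrtr_gt0.
  have sN : 0 < Num.sqrt (g (N x)) by rewrite sqrtr_gt0.
  rewrite -mulrA (le_trans _ (ler_pM _ _ (gK _ xab) (gC _ xab)))//.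
  have -> : g (M x) - g (N x) = (Num.sqrt (g (M x)) - Num.sqrt (g (N x)))
      * (Num.sqrt (g (M x)) + Num.sqrt (g (N x))).
    by rewrite -subr_sqr !sqr_sqrtr ?ltW.
  rewrite normrM mulrCA ler_peMr//.
  rewrite !gtr0_norm ?invr_gt0 ?addr_gt0// mulrDr mulVf ?gt_eqF// lerDl.
  by rewrite mulr_ge0// ?invr_ge0 ltW.
Qed.

(** The sum [e] of the squared entries of [M - N] satisfies [|e'| <= K e] between [s] and [t], since
    the field is Lipschitz along the two curves, and it vanishes at [s]. *)
Lemma integral_curve_unique (X : V -> V) (J : set R) (M N : R -> V) :
    elementary_mx setT X -> is_interval J ->
    integral_curve X J M -> integral_curve X J N ->
  forall s t, J s -> J t -> M s = N s -> M t = N t.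
Proof.
move=> EX intJ MX NX s t Js Jt eMN.
pose a := Num.min s t; pose b := Num.max s t.
have ab : a <= b by rewrite le_max ge_min lexx.
have abJ x : a <= x <= b -> J x.
  rewrite /a /b; have [st|/ltW ts] := leP s t.
    exact: intJ.
  exact: intJ.
have cont (P : R -> V) x : integral_curve X J P -> J x -> {for x, continuous P}.
  move=> PX Jx; apply/differentiable_continuous/derivable1_diffP.
  by have [] := PX _ Jx.
have /choice[C CP] (ij : 'I_m * 'I_n) : exists C, 0 <= C /\
    forall x, a <= x <= b -> `|X (M x) ij.1 ij.2 - X (N x) ij.1 ij.2|
      <= C * `|M x - N x|.
  have [|C C0 CP] := elementary_curve_lipschitz ab (EX ij.1 ij.2) (M := M) (N := N).
    by move=> x /abJ Jx; split; exact: cont Jx.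
  by exists C.
pose e x := \sum_i \sum_j (M x i j - N x i j) ^+ 2.
pose de x := \sum_i \sum_j
  2 * ((M x i j - N x i j) * (X (M x) i j - X (N x) i j)).
pose K := \sum_i \sum_j 2 * C (i, j).
have eM x : `|M x - N x| ^+ 2 <= e x.
  apply: le_trans (sqr_mx_norm_le _) _; apply: ler_sum => i _.
  by apply: ler_sum => j _; rewrite !mxE.
suff : e t <= 0.
  move=> /(le_trans (eM t)); rewrite -[0](expr0n R 2) ler_sqr ?nnegrE//.
  by rewrite normr_le0 subr_eq0 => /eqP.
apply: (@gronwall0 e de K s t); last first.
  by rewrite /e eMN big1// => i _; rewrite big1// => j _; rewrite subrr expr0n.
move=> x xab; have Jx := abJ _ xab; split.
  rewrite /e /de.
  have -> : (fun x => \sum_i \sum_j (M x i j - N x i j) ^+ 2) =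
      \sum_i \sum_j (fun x => (M x i j - N x i j) ^+ 2).
    by apply/funext => y; rewrite fct_sumE; apply: eq_bigr => i _; rewrite fct_sumE.
  apply: is_derive_sum => i; apply: is_derive_sum => j.
  have dM := (is_derive_mxP _ _ _ _).1 (MX _ Jx) i j.
  have dN := (is_derive_mxP _ _ _ _).1 (NX _ Jx) i j.
  have dMN := is_deriveB dM dN.
  apply: (is_derive_eq (is_deriveM dMN dMN)).
  by rewrite /GRing.scale/= -mulr2n mulr_natl.
rewrite /de /K mulr_suml; apply: le_trans (ler_norm_sum _ _ _) _.
apply: ler_sum => i _; rewrite mulr_suml; apply: le_trans (ler_norm_sum _ _ _) _.
apply: ler_sum => j _; rewrite normrM ger0_norm// -mulrA ler_wpM2l//.
have [C0 CX] := CP (i, j).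
apply: le_trans (ler_wpM2l C0 (eM x)); rewrite normrM expr2 mulrCA.
rewrite ler_pM//; last exact: CX.
by have := ler_mx_norm (M x - N x) i j; rewrite !mxE.
Qed.

End Curves.

End Uniqueness.

(** * Signed and permuted LU factorizations *)

Section SignedFactorizations.
Variables (R : realType) (n : nat).
Implicit Types (A B L U F G Q : 'M[R]_n) (s : 'S_n).

Lemma sign_diagP F : sign_diag F <->
  exists2 f : 'rV[R]_n, F = diag_mx f & forall i, f 0 i = 1 \/ f 0 i = -1.
Proof.
split=> [[/diag_mxP[f ->] F1]|[f -> f1]].
  by exists f => // i; have := F1 i; rewrite mxE eqxx mulr1n.
by split=> [|i]; [exact: diag_mx_is_diag|rewrite mxE eqxx mulr1n].
Qed.

Lemma sign_diag_mul_self F : sign_diag F -> F *m F = 1%:M.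
Proof.
move=> /sign_diagP[f -> f1]; rewrite mulmx_diag -diag_const_mx.
by congr diag_mx; apply/rowP => i; rewrite !mxE; case: (f1 i) => ->;
  rewrite ?mulrNN mulr1.
Qed.

Lemma sign_diag_mulK F : sign_diag F -> cancel (@mulmx R n n n F) (mulmx F).
Proof. by move=> sF A; rewrite mulmxA sign_diag_mul_self// mul1mx. Qed.

Lemma sign_diag_tr F : sign_diag F -> F^T = F.
Proof. by move=> /sign_diagP[f -> _]; rewrite tr_diag_mx. Qed.

Lemma sign_diag_orthogonal F : sign_diag F -> orthogonal_mx F.
Proof.
by move=> sF; rewrite /orthogonal_mx/= sign_diag_tr// sign_diag_mul_self.
Qed.

Lemma sign_diag_comm F (d : 'rV[R]_n) :
  sign_diag F -> F *m diag_mx d = diag_mx d *m F.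
Proof. by move=> /sign_diagP[f -> _]; exact: diag_mxC. Qed.

Lemma sign_diagM F G : sign_diag F -> sign_diag G -> sign_diag (F *m G).
Proof.
move=> /sign_diagP[f -> f1] /sign_diagP[g -> g1]; apply/sign_diagP.
rewrite mulmx_diag; eexists; first by [].
by move=> i; rewrite mxE; case: (f1 i) => ->; case: (g1 i) => ->;
  rewrite ?mulrNN ?mulrN ?mulr1 ?mul1r; tauto.
Qed.

Lemma mul_row_perm s A B : row_perm s A *m B = row_perm s (A *m B).
Proof. by rewrite !row_permE mulmxA. Qed.

Lemma row_perm_inj s : injective (@row_perm R n n s).
Proof.
move=> A B /matrixP AB; apply/matrixP => i j.
by have := AB (s^-1%g i) j; rewrite !mxE permKV.
Qed.

Lemma mul_diag_row_perm s (d : 'rV[R]_n) A :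
  diag_mx d *m row_perm s A = row_perm s (diag_mx (col_perm s^-1 d) *m A).
Proof.
by apply/matrixP => i j; rewrite !mul_diag_mx !mxE permK.
Qed.

Lemma row_perm_unitmx s A : A \in unitmx -> row_perm s A \in unitmx.
Proof. by move=> Au; rewrite row_permE unitmx_mul unitmx_perm. Qed.

(** As [F] is an involution, a sign matrix can be moved through [L] by conjugation, which preserves
    the unit diagonal, and then absorbed into [U]. *)
Lemma sign_diag_conj F L U : sign_diag F -> unit_lower L -> upper_mx U ->
  [/\ F *m (L *m U) = F *m L *m F *m (F *m U), unit_lower (F *m L *m F),
      upper_mx (F *m U) & forall i, (F *m U) i i = F i i * U i i].
Proof.
move=> sF [loL L1] upU; split.
- by rewrite -!mulmxA (sign_diag_mulK sF).
- move/sign_diagP : sF => [f -> f1].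
  split=> [|i]; last first.
    by rewrite mul_mx_diag mxE mul_diag_mx mxE L1 mulr1; case: (f1 i) => ->;
      rewrite ?mulrNN mulr1.
  apply/is_trig_mxP => i j ij; rewrite mul_mx_diag mxE mul_diag_mx mxE.
  by rewrite (is_trig_mxP loL)// mulr0 mul0r.
- move/sign_diagP : sF => [f -> f1]; apply/upper_mxP => i j ij.
  by rewrite mul_diag_mx mxE ((upper_mxP U).1 upU)// mulr0.
- move/sign_diagP : sF => [f -> f1] i.
  by rewrite mul_diag_mx !mxE eqxx mulr1n.
Qed.

(** Moving [F] to the right gives two LU factorizations of one matrix, so [F *m U = U']; positivity
    of both diagonals forces [F = 1]. *)
Lemma lu_sign_unique F L L' U U' : sign_diag F ->
    unit_lower L -> unit_lower L' -> pos_upper U -> pos_upper U' ->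
  F *m (L *m U) = L' *m U' -> F = 1%:M /\ L = L'.
Proof.
move=> sF uL uL' [upU U0] [upU' U'0].
have [-> uL2 upU2 U2] := sign_diag_conj sF uL upU => eLU.
have F0 i : F i i = 1 \/ F i i = -1 by exact: sF.2.
have eL : F *m L *m F = L'.
  have <- : luL (F *m L *m F *m (F *m U)) = F *m L *m F.
    apply: luL_mul => // i; rewrite U2.
    apply: mulf_neq0; last by rewrite gt_eqF.
    by case: (F0 i) => ->; rewrite ?oppr_eq0 oner_eq0.
  by rewrite eLU luL_mul// => i; rewrite gt_eqF.
have eU : F *m U = U'.
  move: eLU; rewrite eL => /(congr1 (mulmx (invmx L'))).
  by rewrite !mulKmx ?unit_lower_unitmx.
have F1 : F = 1%:M.
  move/sign_diagP : sF => [f eF f1].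
  rewrite eF -diag_const_mx; congr diag_mx; apply/rowP => i; rewrite [RHS]mxE.
  have := U'0 i; rewrite -eU U2 eF mxE eqxx mulr1n.
  by case: (f1 i) => ->//; rewrite mulN1r oppr_gt0 ltNge ltW.
by split=> //; rewrite -eL F1 mul1mx mulmx1.
Qed.

(** The permuted [L] equals [Q *m invmx U], which is already a QR factorization. *)
Lemma gs_row_perm s Q L U : orthogonal_mx Q -> pos_upper U ->
  Q = row_perm s (L *m U) -> gs_mx (row_perm s L) = Q.
Proof.
move=> oQ pU eQ; have Uu := pos_upper_unitmx pU.
have -> : row_perm s L = Q *m invmx U by rewrite eQ mul_row_perm mulmxK.
by apply: gs_mx_mul => //; exact: pos_upperV.
Qed.

Lemma gs_row_permP s L : unit_lower L ->
  orthogonal_mx (gs_mx (row_perm s L)) /\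
  exists2 U, pos_upper U & gs_mx (row_perm s L) = row_perm s (L *m U).
Proof.
move=> /unit_lower_unitmx Lu; have [oQ [U pU eL]] := gs_mxP (row_perm_unitmx s Lu).
split=> //; exists (invmx U); first exact: pos_upperV.
by rewrite -mul_row_perm {2}eL mulmxK// pos_upper_unitmx.
Qed.

End SignedFactorizations.

Section SignedPLU.
Variables (R : realType) (n : nat).

(** An LUP decomposition [P Q = L U] exists for any invertible [Q]; the signs of the diagonal of [U]
    are pulled out to the left. *)
Lemma signed_plu (Q : 'M[R]_n.+1) : Q \in unitmx ->
  exists s F L U, [/\ sign_diag F, unit_lower L, pos_upper U
    & Q = F *m row_perm s (L *m U)].
Proof.
move=> Qu; have := cormen_lup_correct Q; have := cormen_lup_perm Q.
have := cormen_lup_lower Q; have := cormen_lup_upper Q.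
case: (cormen_lup Q) => [[P L] U] /= upU loL /existsP[s /eqP ->] eQ.
have uL : unit_lower L.
  split=> [|i]; last by rewrite loL// eqxx.
  by apply/is_trig_mxP => i j ij; rewrite loL 1?ltnW// -val_eqE/= ltn_eqF.
have {}upU : upper_mx U by apply/upper_mxP => i j; exact: upU.
have U0 i : U i i != 0.
  have : U \in unitmx.
    have -> : U = invmx L *m (perm_mx s *m Q).
      by rewrite [perm_mx s *m Q]eQ mulKmx// unit_lower_unitmx.
    by rewrite !unitmx_mul unitmx_inv unit_lower_unitmx// unitmx_perm Qu.
  rewrite unitmxE -det_tr det_trig// unitfE => /prodf_neq0/(_ i isT).
  by rewrite mxE.
pose f := \row_i Num.sg (U i i).
have f1 i : f 0 i = 1 \/ f 0 i = -1.
  by rewrite mxE; case: sgrP (U0 i) => //; tauto.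
have sf : sign_diag (diag_mx f) by apply/sign_diagP; exists f.
have [eLU uL' upU' U'] := sign_diag_conj sf uL upU.
(* The sign matrix has to cross the row permutation, which permutes its entries. *)
exists s^-1%g, (diag_mx (col_perm s^-1 f)), (diag_mx f *m L *m diag_mx f),
  (diag_mx f *m U).
split=> //.
- by apply/sign_diagP; exists (col_perm s^-1 f) => // i; rewrite mxE.
- split=> // i; rewrite U' !mxE eqxx mulr1n -normrEsg.
  by rewrite normr_gt0.
- rewrite -eLU mul_diag_row_perm invgK -col_permM mulgV col_perm1.
  rewrite mulmxA (sign_diag_mul_self sf) mul1mx.
  by rewrite -[L *m U]eQ row_permE mulmxA -perm_mxM mulVg perm_mx1 mul1mx.
Qed.

End SignedPLU.

(** * Uniqueness of the singular value decomposition up to common signs *)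

Section SVD.
Variables (R : realType) (n : nat) (mu : 'rV[R]_n).
Hypotheses (mu_gt0 : forall i, 0 < mu 0 i)
  (mu_decr : forall i j : 'I_n, (i < j)%N -> mu 0 j < mu 0 i).

Lemma singular_value_inj i j : mu 0 i ^+ 2 = mu 0 j ^+ 2 -> i = j.
Proof.
move=> /eqP; rewrite eqrXn2 ?ltW// => /eqP eij; apply/val_inj.
by have [/mu_decr|/mu_decr|//] := ltngtP i j; rewrite eij ltxx.
Qed.

Lemma diag_mu_unitmx : diag_mx mu \in unitmx.
Proof.
rewrite unitmxE det_diag unitfE; apply/prodf_neq0 => i _.
by rewrite gt_eqF.
Qed.

(** Write [Q' = F Q] and [U' = H U]. Then [F S = S H], so [F] commutes with [S^2], whose diagonal
    entries are distinct; hence [F] is diagonal and, being orthogonal, a sign matrix. It then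
    commutes with [S], so [H = F]. *)
Lemma svd_unique (Q Q' U U' : 'M[R]_n) :
    orthogonal_mx Q -> orthogonal_mx Q' -> orthogonal_mx U -> orthogonal_mx U' ->
    Q^T *m diag_mx mu *m U = Q'^T *m diag_mx mu *m U' ->
  exists F, [/\ sign_diag F, Q' = F *m Q & U' = F *m U].
Proof.
move=> oQ oQ' oU oU' eM; set S := diag_mx mu in eM *.
have [F F0] : exists F, F = Q' *m Q^T by eexists.
pose H := U' *m U^T.
have Q'Q : Q' = F *m Q by rewrite F0 -mulmxA oQ mulmx1.
have U'U : U' = H *m U by rewrite /H -mulmxA oU mulmx1.
have FS : F *m S = S *m H.
  rewrite F0 /H.
  have := congr1 (fun M => Q' *m M *m U^T) eM => /=.
  rewrite -!mulmxA (orthogonal_mulmxT oU) mulmx1 => ->.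
  by rewrite mulmxA (orthogonal_mulmxT oQ') mul1mx.
have oF : orthogonal_mx F.
  rewrite /orthogonal_mx/= F0 trmx_mul trmxK mulmxA -[_ *m Q'^T *m Q']mulmxA.
  by rewrite oQ' mulmx1 orthogonal_mulmxT.
have oH : H *m H^T = 1%:M.
  rewrite /H trmx_mul trmxK mulmxA -[_ *m U^T *m U]mulmxA.
  by rewrite oU mulmx1 orthogonal_mulmxT.
have St : S^T = S by rewrite /S tr_diag_mx.
(* Multiplying each side of [FS] by its transpose eliminates [H]. *)
have FSS : F *m (S *m S) = S *m S *m F.
  have FSSF : F *m (S *m S) *m F^T = S *m S.
    have -> : F *m (S *m S) *m F^T = F *m S *m (F *m S)^T.
      by rewrite [(F *m S)^T]trmx_mul St !mulmxA.
    by rewrite FS [(S *m H)^T]trmx_mul St -mulmxA (mulmxA H) oH mul1mx.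
  by rewrite -{2}FSSF -!mulmxA oF mulmx1.
have Fdiag i j : i != j -> F i j = 0.
  move=> ij; have /matrixP/(_ i j) := FSS.
  rewrite /S mulmx_diag mul_mx_diag mul_diag_mx !mxE -!expr2 mulrC => /eqP.
  rewrite -subr_eq0 -mulrBl mulf_eq0 => /orP[|/eqP//].
  by rewrite subr_eq0 => /eqP/singular_value_inj ji; rewrite ji eqxx in ij.
have eF : F = diag_mx (\row_i F i i).
  apply/matrixP => i j; rewrite !mxE; have [->|ij] := eqVneq i j.
    by rewrite mulr1n.
  by rewrite mulr0n Fdiag.
have sF : sign_diag F.
  split=> [|i]; first by rewrite eF; exact: diag_mx_is_diag.
  have /matrixP/(_ i i) := oF.
  rewrite mxE (bigD1 i)//= big1 => [|k ki]; last by rewrite [F k i]Fdiag ?mulr0.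
  rewrite addr0 !mxE eqxx -expr2 => /eqP; rewrite sqrf_eq1 => /orP[]/eqP; tauto.
exists F; split=> //; rewrite U'U; congr (_ *m _).
have Su := diag_mu_unitmx.
by rewrite -[LHS](mulKmx Su) -FS sign_diag_comm// mulKmx.
Qed.

End SVD.

(** * Derivatives of the Gram-Schmidt frame and of the SVD product along curves *)

Section MatrixCurves.
Variable R : realType.

Lemma is_derive_mulmx m n k (A : R -> 'M[R]_(m, n)) (B : R -> 'M[R]_(n, k))
    (t : R) dA dB :
  is_derive t (1 : R) A dA -> is_derive t (1 : R) B dB ->
  is_derive t (1 : R) (fun x => A x *m B x) (dA *m B t + A t *m dB).
Proof.
move=> /is_derive_mxP AdA /is_derive_mxP BdB; apply/is_derive_mxP => i j.
have -> : (fun x => (A x *m B x) i j) =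
    \sum_l ((fun x => A x i l) * (fun x => B x l j)).
  by apply/funext => x; rewrite mxE fct_sumE.
rewrite !mxE -big_split/=; apply: is_derive_sum => l.
apply: (is_derive_eq (is_deriveM (AdA i l) (BdB l j))).
by rewrite /GRing.scale/= addrC; congr (_ + _); exact: mulrC.
Qed.

Lemma is_derive_trmx m n (A : R -> 'M[R]_(m, n)) (t : R) dA :
  is_derive t (1 : R) A dA -> is_derive t (1 : R) (fun x => (A x)^T) dA^T.
Proof.
move=> /is_derive_mxP AdA; apply/is_derive_mxP => i j; rewrite mxE.
by have -> : (fun x => (A x)^T i j) = (fun x => A x j i)
  by apply/funext => x; rewrite mxE.
Qed.

Lemma is_derive_unique (V : normedModType R) (f : R -> V) (t : R) d d' :
  is_derive t (1 : R) f d -> is_derive t (1 : R) f d' -> d = d'.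
Proof. by move=> [_ <-] [_ <-]. Qed.

(* If [A = Q U] then [Q^T A' U^-1 = Q^T Q' + U' U^-1] is the decomposition of
   the left-hand side into a skew-symmetric and an upper triangular matrix. *)
Lemma gs_flow n (A : R -> 'M[R]_n) (t : R) (P D : 'M[R]_n) :
    (forall x, A x \in unitmx) -> derivable (fun x => gs_mx (A x)) t (1 : R) ->
    upper_mx D -> is_derive t (1 : R) A (P *m A t - A t *m D) ->
  is_derive t (1 : R) (fun x => gs_mx (A x))
    (gs_mx (A t) *m proj_skew ((gs_mx (A t))^T *m P *m gs_mx (A t))).
Proof.
move=> Au Qd upD dA.
have {Au} QP x := gs_mxP (Au x); pose Q x := gs_mx (A x).
rewrite -/Q in Qd *; have {Qd} dQ : is_derive t (1 : R) Q ('D_1 Q t).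
  exact: derivableP.
move: ('D_1 Q t) dQ => Q' dQ.
have oQ x : (Q x)^T *m Q x = 1%:M by exact: (QP x).1.
(* The triangular factor is expressed through [Q] and [A] in order to inherit their
   differentiability. *)
pose T x := (Q x)^T *m A x.
have pT x : pos_upper (T x).
  by have [_ [U pU eA]] := QP x; rewrite /T eA mulmxA oQ mul1mx.
have eA x : A x = Q x *m T x.
  by rewrite mulmxA (orthogonal_mulmxT (oQ x)) mul1mx.
have dT := is_derive_mulmx (is_derive_trmx dQ) dA; rewrite -/(T _) in dT.
move: (_ + _) dT => T' dT.
have upT' : upper_mx T'.
  apply/upper_mxP => i j ij; have /is_derive_mxP/(_ i j) := dT.
  have -> : (fun x => T x i j) = fun=> 0.
    by apply/funext => x; exact: (upper_mxP _).1 (pT x).1 i j ij.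
  by move/is_derive_unique => /(_ 0); apply; exact: is_derive_cst.
have dA2 : is_derive t (1 : R) A (Q' *m T t + Q t *m T').
  have -> : A = (fun x => Q x *m T x) by apply/funext.
  exact: is_derive_mulmx.
have eA' := is_derive_unique dA dA2.
have skQ : Q'^T *m Q t + (Q t)^T *m Q' = 0.
  have := is_derive_mulmx (is_derive_trmx dQ) dQ.
  have -> : (fun x => (Q x)^T *m Q x) = fun=> 1%:M by apply/funext.
  by move/is_derive_unique; apply; exact: is_derive_cst.
suff -> : proj_skew ((Q t)^T *m P *m Q t) = (Q t)^T *m Q'.
  by rewrite mulmxA (orthogonal_mulmxT (oQ t)) mul1mx.
apply/proj_skewP; split.
  rewrite /skew_mx/= trmx_mul trmxK.
  by apply/eqP; rewrite -addr_eq0 skQ.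
(* Equating the two derivatives of [A] gives [P A - A D = Q' T + Q T'], which is multiplied by [Q^T]
   on the left and by the inverse of [T] on the right. *)
have -> : (Q t)^T *m P *m Q t - (Q t)^T *m Q' =
    (T' + T t *m D) *m invmx (T t).
  have Tu := pos_upper_unitmx (pT t).
  rewrite -[LHS](mulmxK Tu); congr (_ *m _).
  have rearrange (a b c d : 'M[R]_n) : a - d = b + c -> a - b = c + d.
    by move=> /(canRL (subrK d)) ->; rewrite addrC !addrA addNr add0r.
  rewrite mulmxBl; apply: rearrange.
  have := congr1 (mulmx (Q t)^T) eA'; rewrite mulmxBr mulmxDr !mulmxA oQ mul1mx.
  by rewrite -/(T t) -[_ *m A t]mulmxA {1}[A t]eA !mulmxA.
apply: upper_mxM; last exact: (pos_upperV (pT t)).1.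
have /upper_mxP upTD : upper_mx (T t *m D) by apply: upper_mxM => //; exact: (pT t).1.
by apply/upper_mxP => i j ij; rewrite mxE ((upper_mxP _).1 upT')// upTD// addr0.
Qed.

End MatrixCurves.

Section SVDCurves.
Variables (R : realType) (n : nat).
Implicit Types (A Q U S : 'M[R]_n.+1) (p : {poly R}).

Lemma horner_mx_orthogonal A Q p : orthogonal_mx Q ->
  horner_mx (Q^T *m A *m Q) p = Q^T *m horner_mx A p *m Q.
Proof.
move=> oQ; elim/poly_ind: p => [|p c IH].
  by rewrite !rmorph0 mulmx0 mul0mx.
rewrite !rmorphD !rmorphM /= !horner_mx_X !horner_mx_C IH.
rewrite mulmxDr mulmxDl mul_mx_scalar -scalemxAl oQ scalemx1; congr (_ + _).
rewrite -!mulmxE !mulmxA -[_ *m Q *m Q^T]mulmxA orthogonal_mulmxT//.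
by rewrite mulmx1.
Qed.

Lemma svd_gram Q U S : orthogonal_mx Q -> S^T = S ->
  (Q^T *m S *m U)^T *m (Q^T *m S *m U) = U^T *m (S *m S) *m U.
Proof.
move=> oQ St; rewrite !trmx_mul trmxK St !mulmxA.
by rewrite -[_ *m Q *m Q^T]mulmxA orthogonal_mulmxT// mulmx1.
Qed.

Lemma svd_gramT Q U S : orthogonal_mx U -> S^T = S ->
  (Q^T *m S *m U) *m (Q^T *m S *m U)^T = Q^T *m (S *m S) *m Q.
Proof.
move=> oU St; rewrite !trmx_mul trmxK St !mulmxA.
by rewrite -[_ *m U *m U^T]mulmxA orthogonal_mulmxT// mulmx1.
Qed.

(** Product rule: transposing the skew projection in [dQ] produces the minus sign of the second term
    of the field. *)
Lemma svd_flow (Q U : R -> 'M[R]_n.+1) S p (t : R) :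
    orthogonal_mx (Q t) -> orthogonal_mx (U t) -> S^T = S ->
    is_derive t (1 : R) Q
      (Q t *m proj_skew ((Q t)^T *m horner_mx (S *m S) p *m Q t)) ->
    is_derive t (1 : R) U
      (U t *m proj_skew ((U t)^T *m horner_mx (S *m S) p *m U t)) ->
  is_derive t (1 : R) (fun x => (Q x)^T *m S *m U x)
    (svd_field p ((Q t)^T *m S *m U t)).
Proof.
move=> oQ oU St dQ dU.
have dS : is_derive t (1 : R) (fun=> S) 0 by exact: is_derive_cst.
have dM := is_derive_mulmx (is_derive_mulmx (is_derive_trmx dQ) dS) dU.
apply: (is_derive_eq dM); rewrite /svd_field svd_gram// svd_gramT//.
rewrite !horner_mx_orthogonal// mulmx0 addr0 trmx_mul.
have -> : forall A, (proj_skew A)^T = - proj_skew A.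
  by move=> A; have [] := (proj_skewP A (proj_skew A)).1 erefl.
by rewrite !mulNmx addrC !mulmxA.
Qed.

End SVDCurves.

(** * Smooth local choice of the left singular vectors *)

Section LocalFrame.
Variables (R : realType) (n : nat) (mu : 'rV[R]_n.+1).
Hypotheses (mu_gt0 : forall i, 0 < mu 0 i)
  (mu_decr : forall i j : 'I_n.+1, (i < j)%N -> mu 0 j < mu 0 i).
Local Notation S := (diag_mx mu).

Lemma lagrange_polynomial (x : 'rV[R]_n.+1) (j : 'I_n.+1) : injective (x 0) ->
  exists p : {poly R}, forall k, p.[x 0 k] = (k == j)%:R.
Proof.
move=> xinj.
exists (\prod_(k | k != j) ((x 0 j - x 0 k)^-1 *: ('X - (x 0 k)%:P))) => l.
rewrite horner_prod; have [->|lj] := eqVneq l j.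
  rewrite big1// => k kj; rewrite !hornerE mulVf// subr_eq0.
  by apply: contra_neq kj => /xinj ->.
by rewrite (bigD1 l)//= !hornerE subrr mulr0 mul0r.
Qed.

(** The eigenvalues [mu_i^2] of [M M^T] are distinct, so interpolation yields a polynomial producing
    the spectral projection of the [j]-th one, the same for the whole orbit. *)
Lemma svd_projection (j : 'I_n.+1) : exists p : {poly R},
  forall Q U : 'M[R]_n.+1, orthogonal_mx Q -> orthogonal_mx U ->
    horner_mx ((Q^T *m S *m U) *m (Q^T *m S *m U)^T) p =
    Q^T *m delta_mx j j *m Q.
Proof.
have [|p pP] := @lagrange_polynomial (\row_i mu 0 i ^+ 2) j.
  by move=> k l; rewrite !mxE; exact: singular_value_inj.
exists p => Q U oQ oU; rewrite svd_gramT ?tr_diag_mx// horner_mx_orthogonal//.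
congr (_ *m _ *m _); rewrite mulmx_diag horner_mx_diag.
apply/matrixP => k l; rewrite !mxE -expr2.
have := pP k; rewrite mxE => ->.
have [->|kl] := eqVneq k l; first by rewrite mulr1n; case: eqP.
rewrite mulr0n; have [kj|//] := eqVneq k j; have [lj|//] := eqVneq l j.
by rewrite kj lj eqxx in kl.
Qed.

Lemma open_elementary_gt0_fin p q (I : finType) (X : set 'M[R]_(p, q))
    (f : I -> 'M[R]_(p, q) -> R) :
  open X -> (forall i, elementary X (f i)) ->
  open [set x | X x /\ forall i, 0 < f i x].
Proof.
move=> oX Ef; rewrite openE => x [Xx fx0].
have near_f : \forall y \near x, forall i, 0 < f i y.
  apply: (@filter_forall _ _ (fun i y => 0 < f i y) (nbhs x) (nbhs_filter x)) => i.
  exact: cvgr_gt (elementary_continuous (Ef i) Xx) _ (fx0 i).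
by apply: filterS2 (open_nbhs_nbhs (conj oX Xx)) near_f => y.
Qed.

(* Left singular vectors are determined up to sign, and are made to depend
   smoothly on the matrix by normalizing their projections onto the rows of
   [Q0]. *)
Lemma local_left_frame (Q0 : 'M[R]_n.+1) : orthogonal_mx Q0 ->
  exists (X : set 'M[R]_n.+1) (L : 'M[R]_n.+1 -> 'M[R]_n.+1),
  [/\ open X, elementary_mx X L,
      forall U, orthogonal_mx U -> X (Q0^T *m S *m U) /\ L (Q0^T *m S *m U) = Q0
    & forall Q U, orthogonal_mx Q -> orthogonal_mx U -> X (Q^T *m S *m U) ->
        exists2 F, sign_diag F & L (Q^T *m S *m U) = F *m Q].
Proof.
move=> oQ0; have /choice[p pP] := svd_projection.
pose P j (M : 'M[R]_n.+1) := horner_mx (M *m M^T) (p j).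
pose b j M := (Q0 *m P j M *m Q0^T) j j.
have EP X j : elementary_mx X (P j).
  apply: elementary_horner_mx; apply: elementary_mxM; first exact: elementary_mx_id.
  by apply: elementary_mx_tr; exact: elementary_mx_id.
have Eb X j : elementary X (b j).
  apply: elementary_mxM; last exact: elementary_mx_cst.
  by apply: elementary_mxM; first exact: elementary_mx_cst.
pose X := [set M | setT M /\ forall j, 0 < b j M].
pose L M : 'M[R]_n.+1 := \matrix_(j, k) ((Q0 *m P j M) j k / Num.sqrt (b j M)).
have PE j Q U : orthogonal_mx Q -> orthogonal_mx U ->
    Q0 *m P j (Q^T *m S *m U) = Q0 *m Q^T *m delta_mx j j *m Q.
  by move=> oQ oU; rewrite /P pP// !mulmxA.
have deltaE (A B : 'M[R]_n.+1) j k : (A *m delta_mx j j *m B) j k = A j j * B j k.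
  rewrite -mulmxA mxE (bigD1 j)//= big1 ?addr0 => [|i ij]; last first.
    rewrite [X in _ * X]mxE big1 ?mulr0// => l _.
    by rewrite mxE (negbTE ij) mul0r.
  rewrite [X in _ * X]mxE (bigD1 j)//= big1 ?addr0 => [|i ij]; last first.
    by rewrite mxE (negbTE ij) andbF mul0r.
  by rewrite mxE !eqxx mul1r.
have bE j Q U : orthogonal_mx Q -> orthogonal_mx U ->
    b j (Q^T *m S *m U) = (Q0 *m Q^T) j j ^+ 2.
  move=> oQ oU; rewrite /b PE// -mulmxA deltaE expr2; congr (_ * _).
  by rewrite !mxE; apply: eq_bigr => k _; rewrite !mxE mulrC.
(* On the orbit, [X] says that matching rows of [Q0] and [Q] have nonzero inner product; normalizing
   the projected row of [Q0] gives the row of [Q] times the sign of that product. *)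
have LE Q U : orthogonal_mx Q -> orthogonal_mx U -> X (Q^T *m S *m U) ->
    sign_diag (diag_mx (\row_j Num.sg ((Q0 *m Q^T) j j))) /\
    L (Q^T *m S *m U) = diag_mx (\row_j Num.sg ((Q0 *m Q^T) j j)) *m Q.
  move=> oQ oU [_ b0].
  have O0 j : (Q0 *m Q^T) j j != 0.
    by have := b0 j; rewrite bE//; apply: contraTneq => ->; rewrite expr0n ltxx.
  split.
    apply/sign_diagP; eexists; first by [].
    by move=> i; rewrite mxE; case: sgrP (O0 i) => //; tauto.
  apply/matrixP => j k; rewrite mul_diag_mx [LHS]mxE [RHS]mxE bE// PE// deltaE.
  rewrite sqrtr_sqr [X in _ = X * _]mxE mulrAC; congr (_ * _).
  by rewrite -[X in X / _]mulr_sg_norm mulfK// normr_eq0.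
exists X, L; split.
- by apply: open_elementary_gt0_fin => //; exact: openT.
- move=> j k; rewrite /L; under eq_fun do rewrite mxE.
  apply: elementaryM.
    by apply: elementary_mxM; first exact: elementary_mx_cst.
  apply: elementaryV; first by move=> M [_ M0]; rewrite gt_eqF// sqrtr_gt0.
  by apply: elementary_sqrt; first by move=> M [_ M0].
- move=> U oU.
  have XM : X (Q0^T *m S *m U).
    by split=> // j; rewrite bE// orthogonal_mulmxT// mxE eqxx expr1n.
  split=> //; have [_ ->] := LE _ _ oQ0 oU XM.
  rewrite orthogonal_mulmxT// mul_diag_mx; apply/matrixP => i j.
  by rewrite !mxE eqxx sgr1 mul1r.
- by move=> Q U oQ oU /(LE _ _ oQ oU) [sF eF]; eexists; eauto.
Qed.

End LocalFrame.

(** * Linear coordinates for pairs of unit lower triangular matrices *)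

Section Coordinates.
Variables (R : realType) (n : nat).

(** The [n (n - 1)] off-diagonal positions accommodate the strictly lower entries of both triangular
    factors. *)
Definition offdiag := {ij : 'I_n * 'I_n | ij.1 != ij.2}.

Local Notation N := #|{: offdiag}|.

(* A coordinate vector is a matrix with unit diagonal, whose lower and
   (transposed) upper triangles are the two unit lower triangular factors. *)
Definition coord_mx (v : 'cV[R]_N) : 'M[R]_n :=
  \matrix_(i, j) (if insub (i, j) : option offdiag is Some k
                  then v (enum_rank k) 0 else 1).

Definition mx_coord (A : 'M[R]_n) : 'cV[R]_N :=
  \col_k A (val (enum_val k)).1 (val (enum_val k)).2.

Definition lower_part (A : 'M[R]_n) : 'M[R]_n :=
  \matrix_(i, j) (if (i < j)%N then 0 else A i j).

Definition glue_mx (L L' : 'M[R]_n) : 'M[R]_n :=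
  \matrix_(i, j) (if (j < i)%N then L i j else L' j i).

Lemma coord_mx_diag v i : coord_mx v i i = 1.
Proof. by rewrite mxE insubN//= eqxx. Qed.

Lemma coord_mx_offdiag v (k : offdiag) :
  coord_mx v (val k).1 (val k).2 = v (enum_rank k) 0.
Proof. by rewrite mxE -surjective_pairing valK. Qed.

Lemma coord_mxK : cancel coord_mx mx_coord.
Proof.
by move=> v; apply/colP => k; rewrite mxE coord_mx_offdiag enum_valK.
Qed.

Lemma mx_coordK A i j : i != j -> coord_mx (mx_coord A) i j = A i j.
Proof.
move=> ij; have := coord_mx_offdiag (mx_coord A) (exist _ (i, j) ij : offdiag).
by rewrite /= => ->; rewrite mxE enum_rankK.
Qed.

Lemma coord_mx_inj v v' : lower_part (coord_mx v) = lower_part (coord_mx v') ->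
  lower_part (coord_mx v)^T = lower_part (coord_mx v')^T -> v = v'.
Proof.
move=> /matrixP e1 /matrixP e2; apply: (can_inj coord_mxK); apply/matrixP => i j.
have [ij|ji] := ltnP i j.
  by have := e2 j i; rewrite !mxE ltnNge ltnW.
by have := e1 i j; rewrite !mxE ltnNge ji.
Qed.

Lemma lower_part_unit v : unit_lower (lower_part (coord_mx v)).
Proof.
split=> [|i]; last by rewrite mxE ltnn coord_mx_diag.
by apply/is_trig_mxP => i j ij; rewrite mxE ij.
Qed.

Lemma lower_part_tr_unit v : unit_lower (lower_part (coord_mx v)^T).
Proof.
split=> [|i]; last by rewrite mxE ltnn mxE coord_mx_diag.
by apply/is_trig_mxP => i j ij; rewrite mxE ij.
Qed.

Lemma lower_part_glue L L' : unit_lower L ->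
  lower_part (coord_mx (mx_coord (glue_mx L L'))) = L.
Proof.
move=> [/is_trig_mxP loL L1]; apply/matrixP => i j; rewrite mxE.
have [ij|ji|/val_inj->] := ltngtP i j; first by rewrite loL.
  by rewrite mx_coordK ?mxE ?ji// -val_eqE/= gtn_eqF.
by rewrite coord_mx_diag L1.
Qed.

Lemma lower_part_tr_glue L L' : unit_lower L' ->
  lower_part (coord_mx (mx_coord (glue_mx L L')))^T = L'.
Proof.
move=> [/is_trig_mxP loL L1]; apply/matrixP => i j; rewrite mxE.
have [ij|ji|/val_inj->] := ltngtP i j; first by rewrite loL.
  by rewrite mxE mx_coordK ?mxE ?ltnNge ?(ltnW ji)// -val_eqE/= ltn_eqF.
by rewrite mxE coord_mx_diag L1.
Qed.

Lemma elementary_coord_mx X : elementary_mx X coord_mx.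
Proof.
move=> i j; case kE : (insub (i, j) : option offdiag) => [k|].
  have -> : (fun v => coord_mx v i j) = (fun v => v (enum_rank k) 0).
    by apply/funext => v; rewrite mxE kE.
  exact: elementary_coord.
have -> : (fun v => coord_mx v i j) = (fun=> 1).
  by apply/funext => v; rewrite mxE kE.
exact: elementary_cst.
Qed.

Lemma elementary_lower_part p q (X : set 'M[R]_(p, q)) F :
  elementary_mx X F -> elementary_mx X (fun x => lower_part (F x)).
Proof.
move=> EF i j; rewrite /lower_part; under eq_fun do rewrite mxE.
by case: ltnP => _; [exact: elementary_cst|exact: EF].
Qed.

Lemma elementary_mx_coord_glue p q (X : set 'M[R]_(p, q)) F G :
  elementary_mx X F -> elementary_mx X G ->
  elementary_mx X (fun x => mx_coord (glue_mx (F x) (G x))).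
Proof.
move=> EF EG i j; rewrite /mx_coord /glue_mx; under eq_fun do rewrite !mxE.
by case: ltnP => _; [exact: EF|exact: EG].
Qed.

(** These are the eigenvalues of [L |-> D L - L D] on the two factors. A position above the diagonal
    stores an entry of the transposed factor [L'], whence the exchanged indices in the second
    branch. *)
Definition rate_mx (d d' : 'rV[R]_n) : 'M[R]_N :=
  diag_mx (mx_coord (\matrix_(i, j) (if (j < i)%N then d 0 i - d 0 j
                                     else d' 0 j - d' 0 i)))^T.

Lemma diag_commutator (d : 'rV[R]_n) A i j :
  (diag_mx d *m A - A *m diag_mx d) i j = (d 0 i - d 0 j) * A i j.
Proof. by rewrite mul_diag_mx mul_mx_diag !mxE mulrBl [_ * d 0 j]mulrC. Qed.

Lemma coord_flow d d' (w : R -> 'cV[R]_N) (t : R) :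
    is_derive t (1 : R) w (rate_mx d d' *m w t) ->
  let L x := lower_part (coord_mx (w x)) in
  let L' x := lower_part (coord_mx (w x))^T in
  is_derive t (1 : R) L (diag_mx d *m L t - L t *m diag_mx d) /\
  is_derive t (1 : R) L' (diag_mx d' *m L' t - L' t *m diag_mx d').
Proof.
move=> dw L L'.
have dC i j (ij : i != j) : is_derive t (1 : R) (fun x => coord_mx (w x) i j)
    ((if (j < i)%N then d 0 i - d 0 j else d' 0 j - d' 0 i) * coord_mx (w t) i j).
  pose k : offdiag := exist _ (i, j) ij.
  have wE x : coord_mx (w x) i j = w x (enum_rank k) 0.
    exact: (coord_mx_offdiag (w x) k).
  have -> : (fun x => coord_mx (w x) i j) = (fun x => w x (enum_rank k) 0).
    exact/funext.
  rewrite wE; have /is_derive_mxP/(_ (enum_rank k) 0) := dw.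
  by rewrite mul_diag_mx !mxE enum_rankK.
have dc0 (f : R -> R) c d0 : (forall x, f x = c) -> d0 = 0 ->
    is_derive t (1 : R) f d0.
  move=> fc ->; have -> : f = (fun=> c) by exact/funext.
  exact: is_derive_cst.
split; apply/is_derive_mxP => i j; rewrite diag_commutator.
- have [ij|ji|/val_inj ij] := ltngtP i j.
  + by apply: (dc0 _ 0) => [x|]; rewrite !mxE ?ij// mulr0.
  + have LE x : L x i j = coord_mx (w x) i j by rewrite /L mxE ltnNge ltnW.
    have -> : (fun x => L x i j) = (fun x => coord_mx (w x) i j) by exact/funext.
    have ij : i != j by rewrite -val_eqE/= gtn_eqF.
    by apply: (is_derive_eq (dC _ _ ij)); rewrite ji LE.
  + apply: (dc0 _ 1) => [x|]; last by rewrite ij subrr mul0r.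
    by rewrite /L mxE ij ltnn coord_mx_diag.
- have [ij|ji|/val_inj ij] := ltngtP i j.
  + by apply: (dc0 _ 0) => [x|]; rewrite !mxE ?ij// mulr0.
  + have LE x : L' x i j = coord_mx (w x) j i.
      by rewrite /L' mxE ltnNge ltnW// mxE.
    have -> : (fun x => L' x i j) = (fun x => coord_mx (w x) j i) by exact/funext.
    have ij : j != i by rewrite -val_eqE/= ltn_eqF.
    apply: (is_derive_eq (dC _ _ ij)).
    by rewrite ltnNge (ltnW ji) LE.
  + apply: (dc0 _ 1) => [x|]; last by rewrite ij subrr mul0r.
    by rewrite /L' mxE ij ltnn mxE coord_mx_diag.
Qed.

(** The explicit exponential solution is defined for all times, which yields invariance of the chart
    domains. *)
Lemma rate_mx_curve d d' (v : 'cV[R]_N) (s t : R) :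
  let w x := \col_k (expR (rate_mx d d' k k * (x - s)) * v k 0) in
  is_derive t (1 : R) w (rate_mx d d' *m w t) /\ w s = v.
Proof.
move=> w; split; last first.
  by apply/colP => k; rewrite mxE subrr mulr0 expR0 mul1r.
apply/is_derive_mxP => k l; rewrite ord1.
pose c := rate_mx d d' k k.
have -> : (fun x => w x k 0) = (fun x => v k 0 * expR (c * (x - s))).
  by apply/funext => x; rewrite mxE mulrC.
have dlin : is_derive t (1 : R) (fun x : R => c * (x - s)) c.
  have ds := is_deriveB (is_derive_id t (1 : R)) (is_derive_cst s t (1 : R)).
  by apply: (is_derive_eq (is_deriveZ c ds)); rewrite subr0; exact: mulr1.
have dexp := @is_derive1_comp _ expR (fun x => c * (x - s)) t _ _
  (is_derive_expR _) dlin.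
apply: (is_derive_eq (is_deriveZ (v k 0) dexp)).
have -> : (rate_mx d d' *m w t) k 0 = c * w t k 0.
  rewrite /rate_mx mul_diag_mx mxE; congr (_ * _).
  by rewrite /c [in RHS]/rate_mx [RHS]mxE eqxx.
rewrite [w t k 0]mxE -/c /GRing.scale/=; ring.
Qed.

End Coordinates.

Arguments rate_mx {R n}.

(** * Parametrizations of the orbit and the flow in their coordinates *)

Section Charts.
Variables (R : realType) (n : nat) (mu : 'rV[R]_n.+1).
Hypotheses (mu_gt0 : forall i, 0 < mu 0 i)
  (mu_decr : forall i j : 'I_n.+1, (i < j)%N -> mu 0 j < mu 0 i).
Local Notation S := (diag_mx mu).
Local Notation N := #|{: offdiag n.+1}|.
Local Notation index := ('S_n.+1 * 'S_n.+1 * 'M[R]_n.+1)%type.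
Implicit Types (i : index) (v : 'cV[R]_N) (M : 'M[R]_n.+1).

Definition left_frame i v : 'M[R]_n.+1 :=
  gs_mx (row_perm i.1.1 (lower_part (coord_mx v))).

Definition right_frame i v : 'M[R]_n.+1 :=
  i.2 *m gs_mx (row_perm i.1.2 (lower_part (coord_mx v)^T)).

Definition param i v : 'M[R]_n.+1 :=
  (left_frame i v)^T *m S *m right_frame i v.

(** The inverse of [param i] by choice, with default value [0] outside its range; [param_inj] makes
    the choice unique. *)
Definition chart i M : 'cV[R]_N := xget 0 [set v | param i v = M].

Lemma left_frame_orthogonal i v : orthogonal_mx (left_frame i v).
Proof. exact: (gs_row_permP _ (lower_part_unit v)).1. Qed.

Lemma right_frame_orthogonal i v :
  chart_index i -> orthogonal_mx (right_frame i v).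
Proof.
move=> /sign_diag_orthogonal oE; apply: orthogonal_mxM => //.
exact: (gs_row_permP _ (lower_part_tr_unit v)).1.
Qed.

Lemma param_orbit i v : chart_index i -> svd_orbit S (param i v).
Proof.
move=> iE; exists (left_frame i v), (right_frame i v); split=> //.
  exact: left_frame_orthogonal.
exact: right_frame_orthogonal.
Qed.

(** Two decompositions of one matrix differ by a common sign matrix [F]. Positivity of the
    triangular factor on the left forces [F = 1], after which the right frames agree as well. *)
Lemma param_inj i : chart_index i -> injective (param i).
Proof.
move=> iE v v' eM.
have [F [sF eQ eU]] := svd_unique mu_gt0 mu_decr (left_frame_orthogonal i v)
  (left_frame_orthogonal i v') (right_frame_orthogonal v iE)
  (right_frame_orthogonal v' iE) eM.
have uL := lower_part_unit v; have uL' := lower_part_unit v'.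
have [F1 eL] : F = 1%:M /\ lower_part (coord_mx v) = lower_part (coord_mx v').
  have [_ [U pU eQv]] := gs_row_permP i.1.1 uL.
  have [_ [U' pU' eQv']] := gs_row_permP i.1.1 uL'.
  move: eQ; rewrite /left_frame eQv eQv'.
  have /sign_diagP[f eF f1] := sF.
  (* The signs are carried through the permutation, so uniqueness first shows that their permuted
     version is trivial. *)
  rewrite eF mul_diag_row_perm => /row_perm_inj/esym.
  have sf : sign_diag (diag_mx (col_perm (i.1.1)^-1 f)).
    by apply/sign_diagP; eexists; first by []; move=> k; rewrite mxE.
  move=> eLU; have [ef eL] := lu_sign_unique sf uL uL' pU pU' eLU.
  split; last exact: eL.
  rewrite -diag_const_mx; congr diag_mx; apply/rowP => k; rewrite mxE.
  have /matrixP/(_ (i.1.1 k) (i.1.1 k)) := ef.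
  by rewrite !mxE eqxx permK mulr1n.
apply: (coord_mx_inj eL).
move: eU; rewrite F1 mul1mx /right_frame.
move=> /(can_inj (sign_diag_mulK iE)).
have [_ [U pU ->]] := gs_row_permP i.1.2 (lower_part_tr_unit v).
have [_ [U' pU' ->]] := gs_row_permP i.1.2 (lower_part_tr_unit v').
move=> /row_perm_inj eU.
have s1 : sign_diag (1%:M : 'M[R]_n.+1).
  apply/sign_diagP; exists (const_mx 1); first by rewrite diag_const_mx.
  by move=> k; rewrite mxE; left.
apply: (lu_sign_unique s1 _ _ pU pU' _).2; [exact: lower_part_tr_unit..|].
by rewrite mul1mx eU.
Qed.

Lemma paramK i : chart_index i -> cancel (param i) (chart i).
Proof.
move=> iE v; apply: (param_inj iE).
exact: (@xgetPex _ 0 [set v' | param i v' = param i v] (ex_intro _ v erefl)).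
Qed.

Lemma elementary_left_frame i : elementary_mx setT (left_frame i).
Proof.
apply: elementary_gs => [||v]; first exact: openT.
  by apply/elementary_row_perm/elementary_lower_part/elementary_coord_mx.
by apply/row_perm_unitmx/unit_lower_unitmx/lower_part_unit.
Qed.

Lemma elementary_right_frame i : elementary_mx setT (right_frame i).
Proof.
apply: elementary_mxM; first exact: elementary_mx_cst.
apply: elementary_gs => [||v]; first exact: openT.
  apply/elementary_row_perm/elementary_lower_part/elementary_mx_tr.
  exact: elementary_coord_mx.
by apply/row_perm_unitmx/unit_lower_unitmx/lower_part_tr_unit.
Qed.

Lemma elementary_param i : elementary_mx setT (param i).
Proof.
apply: elementary_mxM; last exact: elementary_right_frame.
apply: elementary_mxM; last exact: elementary_mx_cst.
exact/elementary_mx_tr/elementary_left_frame.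
Qed.

(** The inverse permutations give the diagonal matrices [D] with [P D = p(S^2) P], one for each
    frame. *)
Definition rates i (p : {poly R}) : 'M[R]_N :=
  let d := \row_k p.[mu 0 k ^+ 2] in
  rate_mx (col_perm (i.1.1)^-1 d) (col_perm (i.1.2)^-1 d).

(** [gs_flow] is applied to both frames and the results are combined by [svd_flow]. The constant
    sign matrix on the right is harmless because it commutes with the diagonal matrix [p(S^2)]. *)
Lemma param_flow i p (w : R -> 'cV[R]_N) (t : R) : chart_index i ->
  is_derive t (1 : R) w (rates i p *m w t) ->
  is_derive t (1 : R) (fun x => param i (w x)) (svd_field p (param i (w t))).
Proof.
move=> iE dw; pose d := \row_k p.[mu 0 k ^+ 2].
have eP : horner_mx (S *m S) p = diag_mx d.
  rewrite mulmx_diag horner_mx_diag; congr diag_mx.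
  by apply/rowP => k; rewrite !mxE.
have wd : differentiable w t by apply/derivable1_diffP; have [] := dw.
have frame_derivable m k (G : 'cV[R]_N -> 'M[R]_(m, k)) : elementary_mx setT G ->
    derivable (fun x => G (w x)) t (1 : R).
  move=> EG; apply/derivable1_diffP; apply: (@differentiable_comp _ _ _ _ w) => //.
  exact: (elementary_mx_differentiable EG).
have perm_curve s (e : 'rV[R]_n.+1) (L : R -> 'M[R]_n.+1) :
    is_derive t (1 : R) L (diag_mx (col_perm s^-1 e) *m L t
      - L t *m diag_mx (col_perm s^-1 e)) ->
    is_derive t (1 : R) (fun x => row_perm s (L x))
      (diag_mx e *m row_perm s (L t)
       - row_perm s (L t) *m diag_mx (col_perm s^-1 e)).
  move=> /is_derive_mxP dL; apply/is_derive_mxP => k l.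
  have -> : (fun x => row_perm s (L x) k l) = (fun x => L x (s k) l).
    by apply/funext => x; rewrite mxE.
  apply: (is_derive_eq (dL (s k) l)); rewrite mul_diag_row_perm mul_row_perm.
  by rewrite !mxE.
have up_diag (e : 'rV[R]_n.+1) : upper_mx (diag_mx e).
  by rewrite /upper_mx/= tr_diag_mx.
have [dL dL'] := coord_flow dw.
apply: svd_flow.
- exact: left_frame_orthogonal.
- exact: right_frame_orthogonal.
- by rewrite tr_diag_mx.
- rewrite eP; apply: gs_flow (up_diag _) (perm_curve _ _ _ dL).
    by move=> x; apply/row_perm_unitmx/unit_lower_unitmx/lower_part_unit.
  exact: (frame_derivable _ _ (left_frame i) (elementary_left_frame i)).
- rewrite eP.
  have dW := gs_flow _ _ (up_diag _) (perm_curve _ _ _ dL').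
  have dE : is_derive t (1 : R) (fun=> i.2) 0 by exact: is_derive_cst.
  apply: (is_derive_eq (is_derive_mulmx dE (dW _ _))).
  + by move=> x; apply/row_perm_unitmx/unit_lower_unitmx/lower_part_tr_unit.
  (* As the sign matrix is an involution, the bare Gram-Schmidt factor is recovered from
     [right_frame], already known to be elementary. *)
  + have -> : (fun x => gs_mx (row_perm i.1.2 (lower_part (coord_mx (w x))^T))) =
        (fun x => i.2 *m right_frame i (w x)).
      by apply/funext => x; rewrite /right_frame (sign_diag_mulK iE).
    apply: (frame_derivable _ _ (fun v => i.2 *m right_frame i v)).
    apply: elementary_mxM; first exact: elementary_mx_cst.
    exact: elementary_right_frame.
  + rewrite mul0mx add0r mulmxA -/(right_frame i (w t)); congr (_ *m proj_skew _).
    rewrite trmx_mul (sign_diag_tr iE) -!mulmxA; congr (_ *m _).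
    rewrite [RHS]mulmxA (sign_diag_comm _ iE) -[RHS]mulmxA; congr (_ *m _).
    by rewrite (sign_diag_mulK iE).
Qed.

End Charts.

(** * Openness, covering and invariance of the chart domains *)

Section Atlas.
Variables (R : realType) (n : nat) (mu : 'rV[R]_n.+1).
Hypotheses (mu_gt0 : forall i, 0 < mu 0 i)
  (mu_decr : forall i j : 'I_n.+1, (i < j)%N -> mu 0 j < mu 0 i).
Local Notation S := (diag_mx mu).
Local Notation N := #|{: offdiag n.+1}|.
Local Notation index := ('S_n.+1 * 'S_n.+1 * 'M[R]_n.+1)%type.
Implicit Types (i : index) (v : 'cV[R]_N) (M : 'M[R]_n.+1).

Lemma sign_diag_svd F (Q U : 'M[R]_n.+1) : sign_diag F ->
  (F *m Q)^T *m S *m (F *m U) = Q^T *m S *m U.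
Proof.
move=> sF; rewrite trmx_mul (sign_diag_tr sF) -!mulmxA; congr (_ *m _).
by rewrite [S *m _]mulmxA -(sign_diag_comm _ sF) -[_ *m S *m U]mulmxA
  (sign_diag_mulK sF).
Qed.

Lemma row_permK (s : 'S_n.+1) (A : 'M[R]_n.+1) :
  row_perm s (row_perm s^-1 A) = A.
Proof. by rewrite -row_permM mulgV row_perm1. Qed.

Lemma row_permVK (s : 'S_n.+1) (A : 'M[R]_n.+1) :
  row_perm s^-1 (row_perm s A) = A.
Proof. by rewrite -row_permM mulVg row_perm1. Qed.

(** From [M], a local left frame gives [Q] up to signs, then [U] follows, and [luL] extracts the
    triangular factors once permutations and signs are undone. The ambiguity is the same sign matrix
    for [Q] and [U], and cancels in the product. *)
Lemma param_local_inverse i v0 : chart_index i ->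
  exists (X : set 'M[R]_n.+1) (psi : 'M[R]_n.+1 -> 'cV[R]_N),
  [/\ open X, X (param mu i v0), elementary_mx X psi
    & forall M, svd_orbit S M -> X M -> param mu i (psi M) = M].
Proof.
move=> iE; have oQ0 := left_frame_orthogonal i v0.
have [X [L [oX EL X0 XL]]] := local_left_frame mu_gt0 mu_decr oQ0.
(* Solving [M = Q^T S U] for [U], with [L M] as [Q]. *)
pose W M := invmx S *m L M *m M.
pose LQ M := row_perm (i.1.1)^-1 (L M).
pose LU M := row_perm (i.1.2)^-1 (i.2 *m W M).
have ELQ : elementary_mx X LQ by exact: elementary_row_perm.
have [oY EY] := elementary_luL oX ELQ.
have ELU : elementary_mx (X `&` [set M | pivots_gt0 (LQ M)]) LU.
  apply: elementary_row_perm; apply: elementary_mxM.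
    exact: elementary_mx_cst.
  apply: elementary_mxM; last exact: elementary_mx_id.
  apply: elementary_mxM; first exact: elementary_mx_cst.
  by move=> k l; apply: elementary_sub (EL k l) => M [].
have [oZ EZ] := elementary_luL oY ELU.
have Su := diag_mu_unitmx mu_gt0.
have WE (Q U : 'M[R]_n.+1) : orthogonal_mx Q -> L (Q^T *m S *m U) = Q ->
    W (Q^T *m S *m U) = U.
  move=> oQ LQE; rewrite /W LQE -!mulmxA (mulmxA Q) (orthogonal_mulmxT oQ).
  by rewrite mul1mx mulKmx.
exists (X `&` [set M | pivots_gt0 (LQ M)] `&` [set M | pivots_gt0 (LU M)]).
exists (fun M => mx_coord (glue_mx (luL (LQ M)) (luL (LU M)))); split.
- exact: oZ.
- have oU0 := right_frame_orthogonal v0 iE.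
  have [XM LM] := X0 _ oU0; have WM := WE _ _ oQ0 LM.
  split; first split; first exact: XM.
    change (pivots_gt0 (LQ (param mu i v0))); rewrite /LQ /param LM /left_frame.
    have [_ [U pU ->]] := gs_row_permP i.1.1 (lower_part_unit v0).
    by rewrite row_permVK; apply: pivots_gt0_mul => //; exact: lower_part_unit.
  change (pivots_gt0 (LU (param mu i v0))).
  rewrite /LU /param WM /right_frame (sign_diag_mulK iE).
  have [_ [U pU ->]] := gs_row_permP i.1.2 (lower_part_tr_unit v0).
  by rewrite row_permVK; apply: pivots_gt0_mul => //; exact: lower_part_tr_unit.
- apply: elementary_mx_coord_glue; last exact: EZ.
  by move=> k l; apply: elementary_sub (EY k l) => M [].
- move=> M [Q [U [oQ oU ->]]] [[XM pQ] pU].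
  have [F sF LM] := XL _ _ oQ oU XM.
  have oF := sign_diag_orthogonal sF.
  have oFQ := orthogonal_mxM oF oQ; have oFU := orthogonal_mxM oF oU.
  have WM : W (Q^T *m S *m U) = F *m U.
    by rewrite -(sign_diag_svd _ _ sF) WE// sign_diag_svd.
  rewrite /param /left_frame /right_frame.
  rewrite (lower_part_glue _ (luL_unit_lower _)).
  rewrite (lower_part_tr_glue _ (luL_unit_lower _)).
  have -> : gs_mx (row_perm i.1.1 (luL (LQ (Q^T *m S *m U)))) = F *m Q.
    have [T pT eT] := luLP pQ; apply: gs_row_perm oFQ pT _.
    by rewrite -eT /LQ row_permK LM.
  have -> : gs_mx (row_perm i.1.2 (luL (LU (Q^T *m S *m U)))) = i.2 *m (F *m U).
    have [T pT eT] := luLP pU; apply: gs_row_perm pT _.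
      exact: orthogonal_mxM (sign_diag_orthogonal iE) oFU.
    by rewrite -eT /LU row_permK WM.
  by rewrite (sign_diag_mulK iE) (sign_diag_svd _ _ sF).
Qed.

(** [signed_plu] produces signs [F] for [Q] and [G] for [U]. Replacing the pair by [(F Q, F U)]
    keeps [M] and makes the left sign trivial, leaving [F G] as the chart's sign matrix. *)
Lemma param_cover M : svd_orbit S M ->
  exists2 i, chart_index i & range (param mu i) M.
Proof.
move=> [Q [U [oQ oU ->]]].
have [s [F [L [T [sF uL pT eQ]]]]] := signed_plu (orthogonal_unitmx oQ).
have [r [G [L' [T' [sG uL' pT' eU]]]]] := signed_plu (orthogonal_unitmx oU).
have sFG := sign_diagM sF sG.
exists (s, r, F *m G); first exact: sFG.
exists (mx_coord (glue_mx L L')) => //.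
rewrite /param /left_frame /right_frame /= lower_part_glue// lower_part_tr_glue//.
have -> : gs_mx (row_perm s L) = F *m Q.
  apply: gs_row_perm pT _; last by rewrite {1}eQ (sign_diag_mulK sF).
  exact: orthogonal_mxM (sign_diag_orthogonal sF) oQ.
have -> : gs_mx (row_perm r L') = G *m U.
  apply: gs_row_perm pT' _; last by rewrite {1}eU (sign_diag_mulK sG).
  exact: orthogonal_mxM (sign_diag_orthogonal sG) oU.
by rewrite -[F *m G *m _]mulmxA (sign_diag_mulK sG) (sign_diag_svd _ _ sF).
Qed.

Lemma chartK i M : chart_index i -> range (param mu i) M ->
  param mu i (chart mu i M) = M.
Proof. by move=> iE [v _ <-]; rewrite paramK. Qed.

Lemma chart_domain_open i : chart_index i ->
  relatively_open (svd_orbit S) (range (param mu i)).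
Proof.
move=> iE.
(* The largest open set whose trace on the orbit lies in the range: it contains every neighbourhood
   supplied by [param_local_inverse]. *)
exists (\bigcup_(Y in [set Y | open Y /\ svd_orbit S `&` Y `<=` range (param mu i)]) Y).
  by apply: bigcup_open => Y [].
apply/seteqP; split=> [M [v _ <-]|M [SM [Y [_ YU] YM]]]; last exact: YU.
split; first exact: param_orbit.
have [X [psi [oX Xv _ psiK]]] := param_local_inverse v iE.
exists X => //; split=> // M' [SM' XM'].
by exists (psi M') => //; exact: psiK.
Qed.

(** By injectivity of [param], the chart coincides near each point of its domain with the smooth
    local inverse, even though it was defined by choice. *)
Lemma chart_diffeomorphism i : chart_index i ->
  diffeomorphism (range (param mu i)) [set: 'cV[R]_N] (chart mu i).
Proof.
move=> iE; split.
- split=> //.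
  + by move=> M M' /set_mem UM /set_mem UM' e; rewrite -(chartK iE UM) e chartK.
  + move=> v _; exists (param mu i v); first by exists v.
    by rewrite paramK.
- move=> _ [v _ <-]; have [X [psi [oX Xv Epsi psiK]]] := param_local_inverse v iE.
  exists X, psi; split=> //; first exact: elementary_mx_smooth.
  move=> _ [v' _ <-] Xv'; rewrite paramK//.
  by apply: (param_inj mu_gt0 mu_decr iE); rewrite psiK//; exact: param_orbit.
- exists (param mu i); last by move=> M /set_mem; exact: chartK.
  move=> v _; exists setT, (param mu i); split=> //; first exact: openT.
  by apply: elementary_mx_smooth; [exact: openT|exact: elementary_param].
Qed.

Lemma atlas_of_charts : atlas_onto (svd_orbit S) (@chart_index R n.+1)
  (fun i => range (param mu i)) (chart mu).
Proof.
split; [|exact: chart_domain_open|exact: chart_diffeomorphism].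
apply/seteqP; split=> [M /param_cover[i iE UM]|M [i iE [v _ <-]]].
  by exists i.
exact: param_orbit.
Qed.

Lemma elementary_svd_field (p : {poly R}) : elementary_mx setT (@svd_field R n p).
Proof.
have Eproj (F : 'M[R]_n.+1 -> 'M[R]_n.+1) : elementary_mx setT F ->
    elementary_mx setT (fun M => proj_skew (F M)).
  move=> EF k l; under eq_fun do rewrite mxE.
  case: ltngtP => _; [exact: EF|exact/elementaryN/EF|exact: elementary_cst].
have Eid : elementary_mx setT (@id 'M[R]_n.+1) by exact: elementary_mx_id.
have Etr := elementary_mx_tr Eid.
have Eh F : elementary_mx setT F -> elementary_mx setT (fun M => horner_mx (F M) p).
  exact: elementary_horner_mx.
apply: elementary_mxD.
  by apply: elementary_mxM => //; apply/Eproj/Eh; exact: elementary_mxM.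
have EM : elementary_mx setT (fun M => proj_skew (horner_mx (M *m M^T) p) *m M).
  by apply: elementary_mxM => //; apply/Eproj/Eh; exact: elementary_mxM.
by move=> k l; under eq_fun do rewrite mxE; exact/elementaryN/EM.
Qed.

(** The linear curve through the coordinates of [M s] is mapped by [param] to a solution, which must
    be [M] on all of [J] by uniqueness. In particular [M] cannot leave the chart domain. *)
Lemma svd_curve i p (J : set R) (M : R -> 'M[R]_n.+1) (s : R) :
    chart_index i -> is_interval J -> integral_curve (svd_field p) J M ->
    J s -> range (param mu i) (M s) ->
  exists w : R -> 'cV[R]_N,
    [/\ forall t, is_derive t (1 : R) w (rates mu i p *m w t)
      & forall t, J t -> M t = param mu i (w t)].
Proof.
move=> iE intJ dM Js [v _ eMs].
pose w x := \col_k (expR (rates mu i p k k * (x - s)) * v k 0).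
have dw t := (rate_mx_curve _ _ v s t).1.
exists w; split=> [t|t Jt]; first exact: dw.
have dN : integral_curve (svd_field p) J (fun x => param mu i (w x)).
  by move=> x _; apply: param_flow => //; exact: dw.
apply: (integral_curve_unique (elementary_svd_field p) intJ dM dN Js Jt).
by rewrite -eMs; congr (param _ _ _); rewrite /w (rate_mx_curve _ _ v s s).2.
Qed.

End Atlas.

Theorem theorem2 (R : realType) (n : nat) (mu : 'rV[R]_n.+1)
    (mu_gt0 : forall i, 0 < mu 0 i)
    (mu_decr : forall i j : 'I_n.+1, (i < j)%N -> mu 0 j < mu 0 i) :
  let S := svd_orbit (diag_mx mu) in
  exists N : nat, manifold_dim N S /\
  exists (U : 'S_n.+1 * 'S_n.+1 * 'M[R]_n.+1 -> set 'M[R]_n.+1)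
         (phi : 'S_n.+1 * 'S_n.+1 * 'M[R]_n.+1 -> 'M[R]_n.+1 -> 'cV[R]_N),
    atlas_onto S (@chart_index R n.+1) U phi /\
    forall i, chart_index i -> forall p : {poly R},
      (forall (J : set R) (M : R -> 'M[R]_n.+1),
         open J -> is_interval J -> integral_curve (svd_field p) J M ->
         forall s t, J s -> J t -> U i (M s) -> U i (M t)) /\
      exists C : 'M[R]_N, is_diag_mx C /\
        forall (J : set R) (M : R -> 'M[R]_n.+1),
          open J -> is_interval J -> (forall t, J t -> U i (M t)) ->
          (integral_curve (svd_field p) J M <->
           integral_curve (mulmx C) J (phi i \o M)).
Proof.
have [_ chart_open chart_diffeo] := atlas_of_charts mu_gt0 mu_decr.
exists #|{: offdiag n.+1}|; split.
  move=> M SM; have [i iE UM] := param_cover SM.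
  exists (range (param mu i)), setT, (chart mu i); split=> //.
  - exact: chart_open.
  - exact: openT.
  - exact: chart_diffeo.
exists (fun i => range (param mu i)), (chart mu).
split; first exact: atlas_of_charts.
move=> i iE p; split=> [J M oJ intJ dM s t Js Jt UM|].
  by have [w [_ ->//]] := svd_curve iE intJ dM Js UM.
exists (rates mu i p); split; first exact: diag_mx_is_diag.
move=> J M oJ intJ UM; split=> dM t Jt; have nbJ := open_nbhs_nbhs (conj oJ Jt).
  (* The chart image of [M] equals the linear curve [w] on [J], a neighbourhood of [t], so their
     derivatives at [t] agree. *)
  have [w [dw Mw]] := svd_curve iE intJ dM Jt (UM t Jt).
  have chartw x : J x -> chart mu i (M x) = w x.
    by move=> /Mw ->; rewrite paramK.
  rewrite /= chartw//; apply: (near_eq_is_derive _ (dw t)).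
  by apply: filterS nbJ => x Jx; rewrite /= chartw.
(* Conversely, [param] sends a linear curve to a solution, and composing it with the chart gives
   back [M] near [t]. *)
have := param_flow iE (dM t Jt).
rewrite /= chartK//; last exact: UM.
apply: near_eq_is_derive; apply: filterS nbJ => x Jx.
by rewrite chartK//; exact: UM.
Qed.
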